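(* Assuming the Exponential Time Hypothesis (ETH), there is no algorithm that solves \textsc{$k$-Upper Dominating Set} in time $O(n^{o(k)})$, where $n$ is the number of vertices of the input graph.
   Context: Let $G=(V,E)$ be a graph. A set $D\subseteq V$ is dominating if every vertex of $V$ is in $D$ or adjacent to a vertex of $D$. An upper dominating set is a dominating set that is minimal under inclusion (no proper subset is dominating). \textsc{$k$-Upper Dominating Set}: given a graph $G$ and an integer $k$, decide whether $G$ has an upper dominating set of size at least $k$. ETH: there is $\delta>0$ such that 3-SAT on $n$ variables cannot be solved in time $2^{\delta n}$. *)

(* Defs.v *)
From HB Require Import structures.
From mathcomp Require Import all_boot all_order all_algebra.
From mathcomp Require Import all_classical all_reals all_analysis.

Set Implicit Arguments.
Unset Strict Implicit.
Unset Printing Implicit Defensive.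

Import Order.TTheory GRing.Theory Num.Theory.
Import numFieldNormedType.Exports.

Local Open Scope nat_scope.

(* Algorithms are random-access machine programs over natural-number cells,
   with structured control flow and uniform cost.  Addition and truncated
   subtraction are the only arithmetic operations, so that running times are
   polynomially related to those of Turing machines (with unit-cost
   multiplication they would not be). *)
Definition memory := nat -> nat.

Definition upd (s : memory) (a v : nat) : memory :=
  fun b => if b == a then v else s b.

Inductive program :=
| Skip
| Const of nat & nat          (* Const x c   : M[x] := c *)
| Copy of nat & nat           (* Copy x y    : M[x] := M[y] *)
| Add of nat & nat & nat      (* Add x y z   : M[x] := M[y] + M[z] *)
| Sub of nat & nat & nat      (* Sub x y z   : M[x] := M[y] - M[z] *)
| Fetch of nat & nat          (* Fetch x y   : M[x] := M[M[y]] *)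
| Store of nat & nat          (* Store x y   : M[M[x]] := M[y] *)
| Seq of program & program
| If of nat & program & program
| While of nat & program.

(* [exec P s t s'] : started on memory s, P halts after t steps with memory
   s'.  Branches and loops test whether the given cell is nonzero. *)
Inductive exec : program -> memory -> nat -> memory -> Prop :=
| exec_skip s : exec Skip s 1 s
| exec_const x c s : exec (Const x c) s 1 (upd s x c)
| exec_copy x y s : exec (Copy x y) s 1 (upd s x (s y))
| exec_add x y z s : exec (Add x y z) s 1 (upd s x (s y + s z))
| exec_sub x y z s : exec (Sub x y z) s 1 (upd s x (s y - s z))
| exec_fetch x y s : exec (Fetch x y) s 1 (upd s x (s (s y)))
| exec_store x y s : exec (Store x y) s 1 (upd s (s x) (s y))
| exec_seq P Q s t s' u s'' :
    exec P s t s' -> exec Q s' u s'' -> exec (Seq P Q) s (t + u) s''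
| exec_if_true x P Q s t s' :
    s x != 0 -> exec P s t s' -> exec (If x P Q) s t.+1 s'
| exec_if_false x P Q s t s' :
    s x = 0 -> exec Q s t s' -> exec (If x P Q) s t.+1 s'
| exec_while_stop x P s :
    s x = 0 -> exec (While x P) s 1 s
| exec_while_loop x P s t s' u s'' :
    s x != 0 -> exec P s t s' -> exec (While x P) s' u s'' ->
    exec (While x P) s (t + u).+1 s''.

(* The input word fills the cells 0, 1, ...; all other cells are 0.  The answer
   is "yes" when cell 0 is nonzero on halting. *)
Definition answers (P : program) (input : seq nat) (yes : Prop) (t : nat) :=
  exists2 s' : memory,
    exec P (nth 0 input) t s' & (s' 0 != 0 <-> yes).

(* Literals may repeat in a clause, so clauses have one to three literals. *)
Definition literal (n : nat) := ('I_n * bool)%type.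
Definition cnf3 (n : nat) := seq (3.-tuple (literal n)).

Definition satisfiable (n : nat) (phi : cnf3 n) : Prop :=
  exists a : 'I_n -> bool,
    all (fun c : 3.-tuple (literal n) =>
           has (fun l : literal n => a l.1 == l.2) c) phi.

Definition literal_code (n : nat) (l : literal n) : nat := (l.1).*2 + l.2.

Definition sat_input (n : nat) (phi : cnf3 n) : seq nat :=
  [:: n, size phi &
      flatten [seq [seq literal_code l | l <- tval c] | c <- phi]].

(* The bound is read as O*(2^(delta n)): the polynomial factor in the size
   n + m of the formula is needed because the clause list may be arbitrarily
   long, and the successor avoids the bound 0 on the empty formula. *)
Definition solves_3SAT_in_time (R : realType) (P : program) (delta : R) : Prop :=
  exists (C : R) (d : nat), forall (n : nat) (phi : cnf3 n),
    exists2 t : nat, answers P (sat_input phi) (satisfiable phi) t &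
      (t%:R <= C * 2 `^ (delta * n%:R) * (n + size phi).+1%:R ^+ d)%R.

Definition ETH (R : realType) : Prop :=
  exists2 delta : R, (0 < delta)%R &
    ~ exists P : program, solves_3SAT_in_time P delta.

Definition dominating (T : finType) (e : rel T) (D : {set T}) : bool :=
  [forall v, (v \in D) || [exists u in D, e v u]].

Definition upper_dominating (T : finType) (e : rel T) (D : {set T}) : bool :=
  minset (dominating e) D.

Definition has_upper_dominating (T : finType) (e : rel T) (k : nat) : Prop :=
  exists2 D : {set T}, upper_dominating e D & k <= #|D|.

Definition graph_input (n : nat) (e : rel 'I_n) (k : nat) : seq nat :=
  [:: n, k & [seq nat_of_bool (e i j) | i <- enum 'I_n, j <- enum 'I_n]].

(* P is correct on every simple graph and every k, and its running time is
   O(b n k) as the number n of vertices grows, uniformly in k. *)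
Definition solves_UDS_in_time_O (R : realType) (P : program)
    (b : nat -> nat -> R) : Prop :=
  exists (C : R) (n0 : nat), forall (n : nat) (e : rel 'I_n) (k : nat),
    symmetric e -> irreflexive e ->
    exists2 t : nat, answers P (graph_input e k) (has_upper_dominating e k) t &
      (n0 <= n)%N -> (t%:R <= C * b n k)%R.

(* Main.v *)
Require Import Defs.
From HB Require Import structures.
From mathcomp Require Import all_boot all_order all_algebra.
From mathcomp Require Import all_classical all_reals all_analysis.
From mathcomp Require Import zify ring lra.
Import Order.TTheory GRing.Theory Num.Theory.
Import numFieldNormedType.Exports.

Set Implicit Arguments.
Unset Strict Implicit.
Unset Printing Implicit Defensive.

Local Open Scope nat_scope.

(* Fix a large [k] and split the [n] variables into [k] groups, so that a group has
   about [Q = 2 ^ (n / k)] values.  The graph consists of two cliques.  The first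
   has, for each group, a column of vertices for its value, a column for the same
   value in reversed order, and a column checking that the two agree; the second
   has one row per constraint.  Rows see an up-set of every column, so of two
   vertices of a column one dominates nothing that the other does not.  A minimal
   dominating set with at least three vertices therefore lies in the columns and
   has at most one vertex in each, whence at most [3 k] vertices; it has exactly
   [3 k] if and only if its choices form a satisfying assignment.  Each clause is
   turned into at most [Q ^ 3] rows, so no sparsification is needed: the graph has
   [O((m + 1) Q ^ 3)] vertices, and time [N ^ o(k)] on it is [2 ^ (delta n)] up to
   a polynomial once [k] is a large enough constant.

   The reduction is a program of the machine model: it moves its input away, prints
   the adjacency matrix by a compiled program of bounded loops, and runs the
   dominating-set algorithm on relocated memory. *)

(* Domination is monotone in the choices: a larger choice in a column sees more rows, so dominating
   rows only bounds choices from below. The bounds from above come from minimality. Let [b] and [b']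
   be the choices of a group in its value column and its reversed column. A set of full size must
   give the check column a private neighbour, and that row, of threshold [th], is missed by both
   other columns, which says [b <= th <= Q - 1 - b']. Dominating the rows that join the two value
   columns gives [Q - 1 - b' <= b]. Hence [b' = Q - 1 - b].

   With both orders available, up-sets can express [a < b] as well as [b < a], so a row can be
   excused whenever its guess [a] differs from the value [b]. A clause has one row for each triple
   of guesses for the groups of its literals; the row of correct guesses is never excused and is
   dominated exactly when some literal holds.

   Every block of vertices has size [Q ^ 3], for uniform addressing. Digits that a block does not
   read produce twins: twin rows are seen by the same columns, and twin column vertices cannot both
   have a private row. *)
Declare Scope ram_scope.
Delimit Scope ram_scope with ram.
Notation "P ;; Q" := (Seq P Q) (at level 60, right associativity) : ram_scope.
Local Open Scope ram_scope.

(** * Time-bounded total correctness of machine programs *)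

Definition runs (P : program) (s : memory) (T : nat) (post : memory -> Prop) :=
  exists t s', [/\ exec P s t s', t <= T & post s'].

Lemma runs_exec P s t s' T (post : memory -> Prop) :
  exec P s t s' -> t <= T -> post s' -> runs P s T post.
Proof. by move=> e le p; exists t, s'. Qed.

Lemma runs_step P Q s t s' T post :
  exec P s t s' -> runs Q s' T post -> runs (P ;; Q) s (t + T) post.
Proof.
move=> eP [u [s'' [eQ le p]]]; exists (t + u), s''; split => //.
  exact: exec_seq eP eQ.
by rewrite leq_add2l.
Qed.

Lemma runs_seq P Q s T1 T2 (mid post : memory -> Prop) :
  runs P s T1 mid -> (forall s', mid s' -> runs Q s' T2 post) ->
  runs (P ;; Q) s (T1 + T2) post.
Proof.
move=> [t [s' [eP le p]]] /(_ s' p) [u [s'' [eQ le' p']]].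
exists (t + u), s''; split => //; first exact: exec_seq eP eQ.
exact: leq_add.
Qed.

Lemma runs_weaken P s T T' (post post' : memory -> Prop) :
  runs P s T post -> T <= T' -> (forall s', post s' -> post' s') ->
  runs P s T' post'.
Proof.
move=> [t [s' [eP le p]]] le' h; exists t, s'; split => //; last exact: h.
exact: leq_trans le'.
Qed.

Lemma runs_if x P Q s T (post : memory -> Prop) :
  (s x != 0 -> runs P s T post) -> (s x = 0 -> runs Q s T post) ->
  runs (If x P Q) s T.+1 post.
Proof.
move=> hP hQ; have [x0|x0] := eqVneq (s x) 0.
  have [t [s' [e le p]]] := hQ x0; exists t.+1, s'; split => //.
  exact: exec_if_false.
have [t [s' [e le p]]] := hP x0; exists t.+1, s'; split => //.
exact: exec_if_true.
Qed.

Ltac updsimp := rewrite /upd; repeat (case: eqP => ? /=); try lia.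

(** * Relocation *)

(* Cell [a] of the relocated program lives in cell [base + 2 a], where [base] is
   kept in cell 3; cells 4 and 5 are scratch. *)
Definition load (x d : nat) : program :=
  Const d (x + x) ;; Add d d 3 ;; Fetch d d.

Definition save (x : nat) : program :=
  Const 4 (x + x) ;; Add 4 4 3 ;; Store 4 5.

Fixpoint reloc (P : program) : program :=
  match P with
  | Skip => Skip
  | Const x c => Const 5 c ;; save x
  | Copy x y => load y 5 ;; save x
  | Add x y z => load y 5 ;; load z 4 ;; Add 5 5 4 ;; save x
  | Defs.Sub x y z => load y 5 ;; load z 4 ;; Defs.Sub 5 5 4 ;; save x
  | Fetch x y => load y 5 ;; Add 5 5 5 ;; Add 5 5 3 ;; Fetch 5 5 ;; save x
  | Store x y => load y 5 ;; load x 4 ;; Add 4 4 4 ;; Add 4 4 3 ;; Store 4 5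
  | Seq P Q => reloc P ;; reloc Q
  | If x P Q => load x 4 ;; If 4 (reloc P) (reloc Q)
  | While x P => load x 4 ;; While 4 (reloc P ;; load x 4)
  end.

(** The cells in between are left alone; they hold the moved input of the reduction, so both
    memories are unbounded without overlapping. *)
Definition relocated (base : nat) (s s' : memory) :=
  s' 3 = base /\ forall a, s' (base + (a + a)) = s a.

Lemma load_exec base s s' x d : 5 < base -> (d == 4) || (d == 5) ->
  relocated base s s' ->
  exists s'', [/\ exec (load x d) s' 3 s'', s'' d = s x, relocated base s s'' &
                  forall a, a != d -> s'' a = s' a].
Proof.
move=> hb hd [h3 h]; pose u := upd (upd s' d (x + x)) d (x + x + base).
exists (upd u d (s x)).
have hd' : d = 4 \/ d = 5 by move: hd => /orP[/eqP|/eqP]; [left|right].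
split.
- rewrite -[3]/(1 + (1 + 1)); apply: exec_seq; first exact: exec_const.
  apply: exec_seq; first exact: exec_add.
  have -> : upd (upd s' d (x + x)) d
      (upd s' d (x + x) d + upd s' d (x + x) 3) = u.
    by congr upd; rewrite /u /upd eqxx; case: eqP => [|_]; [lia|rewrite h3].
  have -> : s x = u (u d) by rewrite /u /upd eqxx -h; updsimp; congr s'; lia.
  exact: exec_fetch.
- by rewrite /upd eqxx.
- split; first by rewrite /u; updsimp.
  by move=> a; rewrite -h /u; updsimp.
- by move=> a /negPf; rewrite /u /upd => ->.
Qed.

Lemma save_exec base s s' x : 5 < base -> relocated base s s' ->
  exists s'', exec (save x) s' 3 s'' /\ relocated base (upd s x (s' 5)) s''.
Proof.
move=> hb [h3 h]; pose u := upd (upd s' 4 (x + x)) 4 (x + x + base).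
exists (upd u (base + (x + x)) (s' 5)); split.
  rewrite -[3]/(1 + (1 + 1)); apply: exec_seq; first exact: exec_const.
  apply: exec_seq; first exact: exec_add.
  have -> : upd (upd s' 4 (x + x)) 4
      (upd s' 4 (x + x) 4 + upd s' 4 (x + x) 3) = u.
    by congr upd; rewrite /u /upd /= h3.
  have <- : u 4 = base + (x + x) by rewrite /u /upd /= addnC.
  have <- : u 5 = s' 5 by rewrite /u /upd /=.
  exact: exec_store.
split; first by rewrite /u; updsimp.
by move=> a; rewrite /u; updsimp; rewrite -h; congr s'; lia.
Qed.

Lemma relocated_upd base s s' d v : 5 < base -> (d == 4) || (d == 5) ->
  relocated base s s' -> relocated base s (upd s' d v).
Proof.
move=> hb hd [h3 h]; split; first by move: hd => /orP[]/eqP->; updsimp.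
by move=> a; rewrite -h; move: hd => /orP[]/eqP->; updsimp.
Qed.

(** An elementary instruction expands to at most ten; the factor 12 also covers the loads that
    precede tests. *)
Lemma reloc_exec base P s t s2 : 5 < base -> exec P s t s2 ->
  forall s', relocated base s s' ->
  exists t' s2', [/\ exec (reloc P) s' t' s2', t' <= 12 * t &
                     relocated base s2 s2'].
Proof.
move=> hb; elim=> {P s t s2}.
- by move=> s s' h; exists 1, s'; split => //; apply: exec_skip.
- move=> x c s s' h /=.
  have [s2' [e h2]] := save_exec x hb (relocated_upd (d := 5) c hb isT h).
  exists (1 + 3), s2'; split => //.
  by apply: exec_seq e; apply: exec_const.
- move=> x y s s' h /=.
  have [s1 [e1 v1 h1 _]] := load_exec (d := 5) y hb isT h.
  have [s2' [e h2]] := save_exec x hb h1.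
  exists (3 + 3), s2'; rewrite v1 in h2; split => //.
  exact: exec_seq e1 e.
- move=> x y z s s' h /=.
  have [s1 [e1 v1 h1 _]] := load_exec (d := 5) y hb isT h.
  have [s2 [e2 v2 h2 f2]] := load_exec (d := 4) z hb isT h1.
  have h3 := relocated_upd (d := 5) (s2 5 + s2 4) hb isT h2.
  have [s3 [e3 h4]] := save_exec x hb h3.
  exists (3 + (3 + (1 + 3))), s3; split => //.
    apply: exec_seq e1 _; apply: exec_seq e2 _; apply: exec_seq e3.
    exact: exec_add.
  by move: h4; rewrite {1}/upd /= f2 // v1 v2.
- move=> x y z s s' h /=.
  have [s1 [e1 v1 h1 _]] := load_exec (d := 5) y hb isT h.
  have [s2 [e2 v2 h2 f2]] := load_exec (d := 4) z hb isT h1.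
  have h3 := relocated_upd (d := 5) (s2 5 - s2 4) hb isT h2.
  have [s3 [e3 h4]] := save_exec x hb h3.
  exists (3 + (3 + (1 + 3))), s3; split => //.
    apply: exec_seq e1 _; apply: exec_seq e2 _; apply: exec_seq e3.
    exact: exec_sub.
  by move: h4; rewrite {1}/upd /= f2 // v1 v2.
- move=> x y s s' h /=.
  have [s1 [e1 v1 h1 _]] := load_exec (d := 5) y hb isT h.
  pose s2 := upd s1 5 (s1 5 + s1 5); pose s3 := upd s2 5 (s2 5 + s2 3).
  have h3 : relocated base s s3 by do 2! apply: relocated_upd => //.
  have h4 := relocated_upd (d := 5) (s3 (s3 5)) hb isT h3.
  have [s5 [e5 h5]] := save_exec x hb h4.
  exists (3 + (1 + (1 + (1 + 3)))), s5; split => //.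
    apply: exec_seq e1 _; apply: exec_seq; first exact: exec_add.
    apply: exec_seq; first exact: exec_add.
    by apply: exec_seq e5; apply: exec_fetch.
  have e : s3 5 = base + (s y + s y).
    by rewrite /s3 /s2 /upd /= (proj1 h1) v1 addnC.
  by move: h5; rewrite e (proj2 h3) {1}/upd /=.
- move=> x y s s' h /=.
  have [s1 [e1 v1 h1 _]] := load_exec (d := 5) y hb isT h.
  have [s2 [e2 v2 h2 f2]] := load_exec (d := 4) x hb isT h1.
  pose s3 := upd s2 4 (s2 4 + s2 4); pose s4 := upd s3 4 (s3 4 + s3 3).
  have h4 : relocated base s s4 by do 2! apply: relocated_upd => //.
  exists (3 + (3 + (1 + (1 + 1)))), (upd s4 (s4 4) (s4 5)); split => //.
    apply: exec_seq e1 _; apply: exec_seq e2 _.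
    apply: exec_seq; first exact: exec_add.
    apply: exec_seq; first exact: exec_add.
    exact: exec_store.
  have -> : s4 4 = base + (s x + s x).
    by rewrite /s4 /s3 /upd /= (proj1 h2) v2 addnC.
  have -> : s4 5 = s y by rewrite /s4 /s3 /upd /= f2.
  case: h4 => h43 h4; split; first by move: h43; updsimp.
  by move=> a; updsimp.
- move=> P Q s t s1 u s2 _ IHP _ IHQ s' h /=.
  have [t1 [s1' [e1 l1 h1]]] := IHP _ h.
  have [t2 [s2' [e2 l2 h2]]] := IHQ _ h1.
  exists (t1 + t2), s2'; split => //; first exact: exec_seq e1 e2.
  by rewrite mulnDr leq_add.
- move=> x P Q s t s1 x0 _ IH s' h /=.
  have [s2 [e2 v2 h2 _]] := load_exec (d := 4) x hb isT h.
  have [t1 [s1' [e1 l1 h1]]] := IH _ h2.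
  exists (3 + t1.+1), s1'; split => //; last by lia.
  by apply: exec_seq e2 _; apply: exec_if_true => //; rewrite v2.
- move=> x P Q s t s1 x0 _ IH s' h /=.
  have [s2 [e2 v2 h2 _]] := load_exec (d := 4) x hb isT h.
  have [t1 [s1' [e1 l1 h1]]] := IH _ h2.
  exists (3 + t1.+1), s1'; split => //; last by lia.
  by apply: exec_seq e2 _; apply: exec_if_false => //; rewrite v2.
- move=> x P s x0 s' h /=.
  have [s2 [e2 v2 h2 _]] := load_exec (d := 4) x hb isT h.
  exists (3 + 1), s2; split => //.
  by apply: exec_seq e2 _; apply: exec_while_stop => //; rewrite v2.
- move=> x P s t s1 u s2 x0 _ IHP _ IHW s' h /=.
  have [s3 [e3 v3 h3 _]] := load_exec (d := 4) x hb isT h.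
  have [t1 [s1' [e1 l1 h1]]] := IHP _ h3.
  have [t2 [s2' [e2 l2 h2]]] := IHW _ h1.
  (* The simulated rest of the loop starts with a load of the test cell. It is split off because the
     same load closes the current round. *)
  inversion e2; subst.
  exists (3 + (t1 + t0 + u0).+1), s2'; split => //; last by lia.
  apply: exec_seq e3 _; apply: exec_while_loop; rewrite ?v3 //.
    by apply: exec_seq; eassumption.
  by [].
Qed.

(** * A language of bounded loops *)

Inductive expr :=
| EV of nat
| EC of nat
| EAdd of expr & expr
| ESub of expr & expr
| EIn of expr.

(* [CFor x e c] runs [c] with [x = 0, 1, ...], [min(e, M)] times, where [M] is a
   bound fixed for the whole command; this makes running times depend on the
   syntax and on [M] only. *)
Inductive cmd :=
| CSet of nat & expr
| COut of expr
| CSeq of cmd & cmd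
| CIf of expr & cmd & cmd
| CFor of nat & expr & cmd.

Definition vstate := ((nat -> nat) * seq nat)%type.

Section Semantics.
Variables (inp : nat -> nat) (M : nat).

Fixpoint eval (v : nat -> nat) (e : expr) : nat :=
  match e with
  | EV x => v x
  | EC c => c
  | EAdd a b => eval v a + eval v b
  | ESub a b => eval v a - eval v b
  | EIn a => inp (eval v a)
  end.

Fixpoint den (c : cmd) (st : vstate) : vstate :=
  match c with
  | CSet x e => (upd st.1 x (eval st.1 e), st.2)
  | COut e => (st.1, rcons st.2 (eval st.1 e))
  | CSeq c1 c2 => den c2 (den c1 st)
  | CIf e c1 c2 => if eval st.1 e != 0 then den c1 st else den c2 st
  | CFor x e c =>
      iteri (minn (eval st.1 e) M)
            (fun i st => den c (upd st.1 x i, st.2)) st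
  end.
End Semantics.

(** Evaluation is stack-like, with the result in cell [d] and scratch above it. Cell 1 holds the
    base of the moved input, whose cells are two apart. *)
Fixpoint ecode (d : nat) (e : expr) : program :=
  match e with
  | EV x => Copy d (4 + x)
  | EC c => Const d c
  | EAdd a b => ecode d a ;; ecode d.+1 b ;; Add d d d.+1
  | ESub a b => ecode d a ;; ecode d.+1 b ;; Defs.Sub d d d.+1
  | EIn a => ecode d a ;; Add d d d ;; Add d d 1 ;; Fetch d d
  end.

Fixpoint ewf (V K d : nat) (e : expr) : bool :=
  match e with
  | EV x => (x < V) && (d < K)
  | EC c => d < K
  | EAdd a b | ESub a b => ewf V K d a && ewf V K d.+1 b
  | EIn a => ewf V K d a
  end.

Fixpoint ecost (e : expr) : nat :=
  match e with
  | EV _ | EC _ => 1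
  | EAdd a b | ESub a b => ecost a + (ecost b + 1)
  | EIn a => ecost a + 3
  end.

(** With the bound [M] in cell 0, truncated subtraction yields [e - (e - M) = min(e, M)]. A loop
    keeps its length, its counter and the number of rounds left in cells [d], [d + 1], [d + 2]. Cell
    2 is the output pointer. *)
Fixpoint ccode (d : nat) (c : cmd) : program :=
  match c with
  | CSet x e => ecode d e ;; Copy (4 + x) d
  | COut e => ecode d e ;; Store 2 d ;; Const d 2 ;; Add 2 2 d
  | CSeq c1 c2 => ccode d c1 ;; ccode d c2
  | CIf e c1 c2 => ecode d e ;; If d (ccode d c1) (ccode d c2)
  | CFor x e c =>
      ecode d e ;; Defs.Sub d.+1 d 0 ;; Defs.Sub d d d.+1 ;; Const d.+1 0 ;;
      Copy d.+2 d ;;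
      While d.+2 (Copy (4 + x) d.+1 ;; ccode d.+3 c ;; Const d.+2 1 ;;
                  Add d.+1 d.+1 d.+2 ;; Defs.Sub d.+2 d d.+1)
  end.

Fixpoint cwf (V K d : nat) (c : cmd) : bool :=
  match c with
  | CSet x e => (x < V) && ewf V K d e
  | COut e => ewf V K d e
  | CSeq c1 c2 => cwf V K d c1 && cwf V K d c2
  | CIf e c1 c2 => [&& ewf V K d e, cwf V K d c1 & cwf V K d c2]
  | CFor x e c => [&& x < V, d.+2 < K, ewf V K d e & cwf V K d.+3 c]
  end.

Fixpoint ccost (M : nat) (c : cmd) : nat :=
  match c with
  | CSet x e => ecost e + 1
  | COut e => ecost e + 3
  | CSeq c1 c2 => ccost M c1 + ccost M c2
  | CIf e c1 c2 => ecost e + (ccost M c1 + ccost M c2).+1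
  | CFor x e c => ecost e + (4 + (M * (ccost M c + 5)).+1)
  end.

Fixpoint depth (c : cmd) : nat :=
  match c with
  | CSet _ _ | COut _ => 0
  | CSeq c1 c2 | CIf _ c1 c2 => maxn (depth c1) (depth c2)
  | CFor _ _ c => (depth c).+1
  end.

Lemma ccost_poly c : exists a, forall M, ccost M c <= a * M.+1 ^ depth c.
Proof.
elim: c => [x e|e|c1 [a1 h1] c2 [a2 h2]|e c1 [a1 h1] c2 [a2 h2]|x e c [a h]] /=.
- by exists (ecost e + 1) => M; rewrite expn0 muln1.
- by exists (ecost e + 3) => M; rewrite expn0 muln1.
- exists (a1 + a2) => M; rewrite mulnDl leq_add //.
    by apply: (leq_trans (h1 M)); rewrite leq_mul // leq_pexp2l // leq_maxl.
  by apply: (leq_trans (h2 M)); rewrite leq_mul // leq_pexp2l // leq_maxr.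
- exists (ecost e + (a1 + a2).+1) => M.
  have hm : 1 <= M.+1 ^ maxn (depth c1) (depth c2) by rewrite expn_gt0.
  have {}h1 : ccost M c1 <= a1 * M.+1 ^ maxn (depth c1) (depth c2).
    by apply: (leq_trans (h1 M)); rewrite leq_mul // leq_pexp2l // leq_maxl.
  have {}h2 : ccost M c2 <= a2 * M.+1 ^ maxn (depth c1) (depth c2).
    by apply: (leq_trans (h2 M)); rewrite leq_mul // leq_pexp2l // leq_maxr.
  by move: (M.+1 ^ _) hm h1 h2 => z; nia.
- exists (ecost e + a + 10) => M; rewrite expnS.
  have hm : 1 <= M.+1 ^ depth c by rewrite expn_gt0.
  by move: (M.+1 ^ _) hm (h M) => z; nia.
Qed.

Section Compile.
Variables (inp : nat -> nat) (V K B M : nat).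
Hypothesis leKB : K <= B.
Hypothesis ltVK : 4 + V < K.

(** Input and output interleave from [B] on, so neither needs a length bound. The output base in
    cell 3 is also the base expected by [reloc]: the printed word becomes the input of the relocated
    program without being copied. *)
Record represents (st : vstate) (s : memory) : Prop := Represents {
  rep_bound : s 0 = M;
  rep_inbase : s 1 = B;
  rep_outptr : s 2 = B.+1 + (size st.2 + size st.2);
  rep_outbase : s 3 = B.+1;
  rep_var : forall x, x < V -> s (4 + x) = st.1 x;
  rep_in : forall i, s (B + (i + i)) = inp i;
  rep_out : forall i, s (B.+1 + (i + i)) = nth 0 st.2 i }.

Lemma represents_frame st s s' : represents st s ->
  (forall a, a < 4 + V \/ K <= a -> s' a = s a) -> represents st s'.
Proof.
case=> h0 h1 h2 h3 hv hi ho f.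
by split=> *; rewrite f ?h0 ?h1 ?h2 ?h3 ?hv ?hi ?ho //; lia.
Qed.

Lemma ewf_lt e d : ewf V K d e -> d < K.
Proof.
elim: e d => [x|c|x Hx y _|x Hx y _|x Hx] d //=; first by case/andP.
all: by [case/andP=> /Hx | move=> /Hx].
Qed.

Lemma ecode_exec e d st s : 4 + V <= d -> ewf V K d e -> represents st s ->
  exists s', [/\ exec (ecode d e) s (ecost e) s', s' d = eval inp st.1 e &
                 forall a, a < d \/ K <= a -> s' a = s a].
Proof.
elim: e d s => [x|c|a IHa b IHb|a IHa b IHb|a IHa] d s hd /=.
- move=> /andP[xV dK] rs; exists (upd s d (s (4 + x))); split.
  + exact: exec_copy.
  + by rewrite /upd eqxx (rep_var rs).
  + by move=> a ha; updsimp.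
- move=> dK rs; exists (upd s d c); split.
  + exact: exec_const.
  + by rewrite /upd eqxx.
  + by move=> a ha; updsimp.
- move=> /andP[wa wb] rs; have [s1 [e1 v1 f1]] := IHa d s hd wa rs.
  have rs1 : represents st s1 by apply: represents_frame rs _ => z hz; apply: f1; lia.
  have [s2 [e2 v2 f2]] := IHb d.+1 s1 (leqW hd) wb rs1.
  exists (upd s2 d (s2 d + s2 d.+1)); split.
  + by apply: exec_seq e1 _; apply: exec_seq e2 _; apply: exec_add.
  + by rewrite /upd eqxx v2 f2 ?v1 //; lia.
  + have dK := ewf_lt wa.
    by move=> z hz; rewrite /upd; case: eqP => [|_]; [lia|rewrite f2 ?f1 //; lia].
- move=> /andP[wa wb] rs; have [s1 [e1 v1 f1]] := IHa d s hd wa rs.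
  have rs1 : represents st s1 by apply: represents_frame rs _ => z hz; apply: f1; lia.
  have [s2 [e2 v2 f2]] := IHb d.+1 s1 (leqW hd) wb rs1.
  exists (upd s2 d (s2 d - s2 d.+1)); split.
  + by apply: exec_seq e1 _; apply: exec_seq e2 _; apply: exec_sub.
  + by rewrite /upd eqxx v2 f2 ?v1 //; lia.
  + have dK := ewf_lt wa.
    by move=> z hz; rewrite /upd; case: eqP => [|_]; [lia|rewrite f2 ?f1 //; lia].
- move=> wa rs; have [s1 [e1 v1 f1]] := IHa d s hd wa rs.
  have dK := ewf_lt wa.
  have rs1 : represents st s1 by apply: represents_frame rs _ => z hz; apply: f1; lia.
  pose s2 := upd s1 d (s1 d + s1 d); pose s3 := upd s2 d (s2 d + s2 1).
  exists (upd s3 d (s3 (s3 d))); split.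
  + apply: exec_seq e1 _; rewrite -[3]/(1 + (1 + 1)).
    apply: exec_seq; first exact: exec_add.
    by apply: exec_seq; [exact: exec_add|exact: exec_fetch].
  + have s3d : s3 d = B + (eval inp st.1 a + eval inp st.1 a).
      rewrite /s3 /s2 /upd !eqxx v1; case: eqP => [|_]; first lia.
      by rewrite (rep_inbase rs1) addnC.
    rewrite s3d {1}/upd eqxx -(rep_in rs1) /s3 /s2.
    by updsimp.
  + by move=> z hz; rewrite /s3 /s2; updsimp; apply: f1.
Qed.

Lemma represents_set st s x a : x < V -> represents st s ->
  represents (upd st.1 x a, st.2) (upd s (4 + x) a).
Proof.
move=> xV [h0 h1 h2 h3 hv hi ho]; split=> //=.
- by move=> y yV; rewrite /upd eqn_add2l; case: eqP => // _; rewrite hv.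
- by move=> i; updsimp.
- by move=> i; updsimp.
Qed.

(** This range contains the registers of the enclosing loops, which a loop body must preserve. *)
Let frame d (s s' : memory) := forall a, 4 + V <= a < d -> s' a = s a.

Lemma ccode_runs c d st s : 4 + V <= d -> cwf V K d c -> represents st s ->
  runs (ccode d c) s (ccost M c)
       (fun s' => represents (den inp M c st) s' /\ frame d s s').
Proof.
elim: c d st s => [x e|e|c1 IH1 c2 IH2|e c1 IH1 c2 IH2|x e c IH] d st s hd /=.
- move=> /andP[xV we] rs; have [s1 [e1 v1 f1]] := ecode_exec hd we rs.
  apply: (runs_step e1); apply: (runs_exec (exec_copy _ _ _)) => //.
  rewrite v1; split; last first.
    by move=> a ha; rewrite /upd; case: eqP => [|_]; [lia|apply: f1; lia].
  apply: represents_set => //; apply: represents_frame rs _ => z hz.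
  by apply: f1; lia.
- move=> we rs; have [s1 [e1 v1 f1]] := ecode_exec hd we rs.
  have dK := ewf_lt we.
  apply: (runs_step e1); rewrite -[3]/(1 + (1 + 1)).
  apply: (runs_step (exec_store _ _ _)); apply: (runs_step (exec_const _ _ _)).
  apply: (runs_exec (exec_add _ _ _ _)) => //.
  have rs1 : represents st s1.
    by apply: represents_frame rs _ => z hz; apply: f1; lia.
  case: (rs1) => h0 h1 h2 h3 hv hi ho.
  rewrite v1 h2; split; last first.
    by move=> a ha; updsimp; apply: f1; lia.
  split; rewrite /= ?size_rcons.
  + by updsimp.
  + by updsimp.
  + by rewrite -?h2 /upd eqxx; repeat (case: eqP => ? /=); lia.
  + by updsimp.
  + by move=> y yV; rewrite -hv //; updsimp.
  + by move=> i; rewrite -hi; updsimp.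
  + move=> i; rewrite nth_rcons; case: ltngtP => i1; updsimp; rewrite ho //.
    by rewrite nth_default // ltnW.
- move=> /andP[w1 w2] rs.
  apply: (runs_seq (IH1 d st s hd w1 rs)) => s1 [rs1 f1].
  apply: (runs_weaken (IH2 d _ s1 hd w2 rs1)) => // s2 [rs2 f2].
  by split=> // a ha; rewrite f2 // f1.
- move=> /and3P[we w1 w2] rs; have [s1 [e1 v1 f1]] := ecode_exec hd we rs.
  have rs1 : represents st s1.
    by apply: represents_frame rs _ => z hz; apply: f1; lia.
  apply: (runs_step e1); apply: runs_if => hx; rewrite v1 in hx.
    apply: (runs_weaken (IH1 d _ s1 hd w1 rs1)); first exact: leq_addr.
    rewrite hx => s2 [rs2 f2]; split=> // a ha; rewrite f2 // f1 //; lia.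
  apply: (runs_weaken (IH2 d _ s1 hd w2 rs1)); first exact: leq_addl.
  rewrite hx => s2 [rs2 f2]; split=> // a ha; rewrite f2 // f1 //; lia.
- move=> /and4P[xV dK we wc] rs; have [s1 [e1 v1 f1]] := ecode_exec hd we rs.
  have rs1 : represents st s1.
    by apply: represents_frame rs _ => z hz; apply: f1; lia.
  apply: (runs_step e1).
  rewrite -[4 + _]/(1 + (1 + (1 + (1 + _)))).
  apply: (runs_step (exec_sub _ _ _ _)); apply: (runs_step (exec_sub _ _ _ _)).
  apply: (runs_step (exec_const _ _ _)); apply: (runs_step (exec_copy _ _ _)).
  set n := minn (eval inp st.1 e) M.
  set s2 := upd _ d.+2 _.
  have s2d : s2 d = n.
    rewrite /s2 /upd !eqxx v1 (rep_bound rs1).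
    by repeat (case: eqP => ? /=); rewrite /n; lia.
  have s2d1 : s2 d.+1 = 0 by rewrite /s2; updsimp.
  have s2d2 : s2 d.+2 = n - 0 by rewrite -s2d /s2; updsimp.
  have f2 a : a < d \/ K <= a -> s2 a = s1 a.
    by move=> ha; rewrite /s2; updsimp.
  have rs2 : represents st s2.
    by apply: represents_frame rs1 _ => z hz; apply: f2; lia.
  have frame2 : frame d s s2 by move=> a ha; rewrite f2 ?f1 //; lia.
  have nM : n <= M by rewrite geq_minr.
  clearbody s2; move: s2d s2d1 s2d2 rs2 frame2; clear s1 e1 v1 f1 rs1 f2.
  pose body := fun i (st : vstate) => den inp M c (upd st.1 x i, st.2).
  rewrite -[X in represents X s2]/(iteri 0 body st) -/body.
  (* Loop invariant at the start of round [i], with the time of the remaining rounds. *)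
  suff H i : i <= n -> forall s2, s2 d = n -> s2 d.+1 = i -> s2 d.+2 = n - i ->
      represents (iteri i body st) s2 -> frame d s s2 ->
      runs (While d.+2 (Copy (4 + x) d.+1 ;; ccode d.+3 c ;; Const d.+2 1 ;;
                  Add d.+1 d.+1 d.+2 ;; Defs.Sub d.+2 d d.+1)) s2
        ((n - i) * (ccost M c + 5) + 1)
        (fun s' => represents (iteri n body st) s' /\ frame d s s').
    move=> h1 h2 h3 h4 h5; apply: (runs_weaken (H 0 _ s2 h1 h2 h3 h4 h5)) => //.
    by rewrite subn0 addn1 ltnS leq_mul2r nM orbT.
  have [k] : exists k, n - i = k by exists (n - i).
  elim: k i => [|k IHk] i hk hin s3 h1 h2 h3 h4 h5.
    have z : s3 d.+2 = 0 by rewrite h3.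
    have <- : i = n by lia.
    by rewrite subnn mul0n; apply: (runs_exec (exec_while_stop _ z)); last split.
  have r1 := represents_set i xV h4.
  have [|t [s4 [e4 t4 [r4 f4]]]] := IH d.+3 _ _ _ wc r1; first lia.
  pose s5 := upd s4 d.+2 1; pose s6 := upd s5 d.+1 (s5 d.+1 + s5 d.+2).
  pose s7 := upd s6 d.+2 (s6 d - s6 d.+1).
  have s4d : s4 d = n by rewrite f4; [rewrite -h1; updsimp|lia].
  have s4d1 : s4 d.+1 = i by rewrite f4; [rewrite -h2; updsimp|lia].
  have f7 a : a < d \/ K <= a -> s7 a = s4 a.
    by move=> ha; rewrite /s7 /s6 /s5; updsimp.
  have r7 : represents (iteri i.+1 body st) s7.
    by apply: represents_frame r4 _ => z hz; apply: f7; lia.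
  have [||||||u [s8 [e8 t8 p8]]] := IHk i.+1 _ _ s7 _ _ _ r7.
  - lia.
  - lia.
  - by rewrite /s7 /s6 /s5; updsimp.
  - by rewrite /s7 /s6 /s5 -s4d1; updsimp.
  - by rewrite /s7 /s6 /s5 -{1}s4d -{1}s4d1; updsimp.
  - move=> a ha; rewrite -h5 // f7; last lia.
    by rewrite f4; [updsimp|lia].
  exists ((1 + (t + (1 + (1 + 1))) + u).+1), s8; split=> //; last first.
    have -> : n - i = (n - i.+1).+1 by lia.
    by rewrite mulSn; move: t4 t8; lia.
  apply: exec_while_loop e8; first by rewrite h3 hk.
  apply: exec_seq; first exact: exec_copy.
  rewrite h2; apply: exec_seq e4 _.
  apply: exec_seq; first exact: exec_const.
  by apply: exec_seq; [exact: exec_add|exact: exec_sub].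
Qed.
End Compile.

(** * Moving the input out of the way *)

(** Low cells form a concrete list and the others an abstract function, so that straight-line code
    is executed by computation on the list. *)
Definition regs (s : memory) (l : seq nat) (h : nat -> nat) :=
  (forall i, i < 8 -> s i = nth 0 l i) /\ (forall a, 8 <= a -> s a = h a).

Lemma regs_upd s l h x c : x < 8 -> regs s l h ->
  regs (upd s x c) (set_nth 0 l x c) h.
Proof.
move=> x8 [hl hh]; split=> i hi.
  by rewrite nth_set_nth /= /upd; case: eqP => // _; apply: hl.
by rewrite /upd; case: eqP => [|_]; [lia|apply: hh].
Qed.

Lemma regs_eq s l l' h h' : regs s l h -> l = l' ->
  (forall a, 8 <= a -> h a = h' a) -> regs s l' h'.
Proof. by move=> [rl rh] <- eh; split=> // a ha; rewrite rh ?eh. Qed.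

Section RegsSteps.
Variables (s : memory) (l : seq nat) (h : nat -> nat).
Variables (P : program) (T : nat) (post : memory -> Prop).
Hypothesis rs : regs s l h.
Local Notation continue l h := (forall s, regs s l h -> runs P s T post).

Lemma regs_const x c : x < 8 ->
  continue (set_nth 0 l x c) h -> runs (Const x c ;; P) s (1 + T) post.
Proof.
by move=> x8 k; apply: (runs_step (exec_const _ _ _)); apply/k/regs_upd.
Qed.

Lemma regs_copy x y : x < 8 -> y < 8 ->
  continue (set_nth 0 l x (nth 0 l y)) h -> runs (Copy x y ;; P) s (1 + T) post.
Proof.
move=> x8 y8 k; apply: (runs_step (exec_copy _ _ _)); apply: k.
by rewrite (proj1 rs) //; apply: regs_upd.
Qed.

Lemma regs_add x y z : x < 8 -> y < 8 -> z < 8 ->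
  continue (set_nth 0 l x (nth 0 l y + nth 0 l z)) h ->
  runs (Add x y z ;; P) s (1 + T) post.
Proof.
move=> x8 y8 z8 k; apply: (runs_step (exec_add _ _ _ _)); apply: k.
by rewrite !(proj1 rs) //; apply: regs_upd.
Qed.

Lemma regs_sub x y z : x < 8 -> y < 8 -> z < 8 ->
  continue (set_nth 0 l x (nth 0 l y - nth 0 l z)) h ->
  runs (Defs.Sub x y z ;; P) s (1 + T) post.
Proof.
move=> x8 y8 z8 k; apply: (runs_step (exec_sub _ _ _ _)); apply: k.
by rewrite !(proj1 rs) //; apply: regs_upd.
Qed.

Lemma regs_fetch x y : x < 8 -> y < 8 -> 8 <= nth 0 l y ->
  continue (set_nth 0 l x (h (nth 0 l y))) h ->
  runs (Fetch x y ;; P) s (1 + T) post.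
Proof.
move=> x8 y8 ly k; apply: (runs_step (exec_fetch _ _ _)); apply: k.
by rewrite (proj1 rs y) // (proj2 rs) //; apply: regs_upd.
Qed.

Lemma regs_store x y : x < 8 -> y < 8 -> 8 <= nth 0 l x ->
  continue l (upd h (nth 0 l x) (nth 0 l y)) ->
  runs (Store x y ;; P) s (1 + T) post.
Proof.
move=> x8 y8 lx k; apply: (runs_step (exec_store _ _ _)); apply: k.
rewrite !(proj1 rs) //; split=> i hi.
  by rewrite /upd; case: eqP => [|_]; [lia|apply: (proj1 rs)].
by rewrite /upd; case: eqP => // _; apply: (proj2 rs).
Qed.
End RegsSteps.

(* The two live cells hold [n] and [m]; Fibonacci steps raise them reversibly
   until cell 1 exceeds every input address, which frees cell 2, then 3, ... *)
Definition climb (P : program) : program := Add 0 0 1 ;; Add 1 1 0 ;; P.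
Definition descend (P : program) : program :=
  Defs.Sub 1 1 0 ;; Defs.Sub 0 0 1 ;; P.

Definition evacuate (P : program) : program :=
  climb (climb (climb (Store 1 2 ;; Const 2 1 ;;
  Add 1 1 2 ;; Store 1 3 ;; Add 1 1 2 ;; Store 1 4 ;; Add 1 1 2 ;; Store 1 5 ;;
  Add 1 1 2 ;; Store 1 6 ;; Add 1 1 2 ;; Store 1 7 ;;
  Const 2 5 ;; Defs.Sub 1 1 2 ;; Copy 3 1 ;;
  descend (descend (descend P))))).

Definition move_cell (P : program) : program :=
  Add 7 7 5 ;; Fetch 6 3 ;; Store 7 6 ;; Add 3 3 2 ;; P.

(** The new base [B = K + 6 + z] lies beyond the six cells saved at [z]. The loop moves the
    [3 m - 6] input cells from address 8 on; then [n], [m] and the saved cells follow. *)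
Definition spread (K : nat) (P : program) : program :=
  Const 4 (K + 6) ;; Add 4 4 3 ;; Add 5 1 1 ;; Add 5 5 1 ;;
  Const 2 6 ;; Defs.Sub 5 5 2 ;; Const 2 1 ;;
  While 5 (Defs.Sub 5 5 2 ;; Const 7 8 ;; Add 7 7 5 ;; Fetch 6 7 ;;
           Add 7 7 7 ;; Add 7 7 4 ;; Store 7 6 ;; Skip) ;;
  Store 4 0 ;; Const 5 2 ;; Add 7 4 5 ;; Store 7 1 ;;
  move_cell (move_cell (move_cell (move_cell (move_cell (move_cell P))))).

Definition relocate_input (K b : nat) : program :=
  evacuate (spread K (Add 0 0 1 ;; Const 2 b ;; Add 0 0 2 ;; Copy 1 4 ;;
    Const 2 1 ;; Add 3 4 2 ;; Copy 2 3 ;; Skip)).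

Ltac step_regs :=
  let s := fresh "s" in let rs := fresh "rs" in
  lazymatch goal with rs0 : regs _ _ _ |- _ =>
  (first [ eapply (regs_const rs0); [done|]
         | eapply (regs_copy rs0); [done|done|]
         | eapply (regs_add rs0); [done|done|done|]
         | eapply (regs_sub rs0); [done|done|done|]
         | eapply (regs_fetch rs0); [done|done| rewrite /=; lia|]
         | eapply (regs_store rs0); [done|done| rewrite /=; lia|] ]);
  clear rs0; move=> s rs; rewrite /= in rs end.

Ltac normalize_regs l h :=
  let rs := fresh "rs" in
  lazymatch goal with rs0 : regs ?s _ _ |- _ =>
  have rs : regs s l h; [apply: (regs_eq rs0)|clear rs0] end.

(** Three climbs turn [(n, m)] into [(5 n + 8 m, 8 n + 13 m)]. For positive [n] and [m] the second
    number is past the end [3 m + 2] of the input and clear of the eight registers. *)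
Lemma evacuate_runs (inp : nat -> nat) (n m : nat) P T post :
  inp 0 = n -> inp 1 = m -> 0 < n -> 0 < m ->
  (forall s z h x2 x4 x5 x6 x7, 8 * n + 13 * m = z ->
    regs s [:: n; m; x2; z; x4; x5; x6; x7] h ->
    (forall j, j < 6 -> h (z + j) = inp (2 + j)) ->
    (forall a, 8 <= a -> a < z \/ z + 6 <= a -> h a = inp a) ->
    runs P s T post) ->
  runs (evacuate P) inp (27 + T) post.
Proof.
move=> i0 i1 n0 m0 hP.
have rs : regs inp [:: n; m; inp 2; inp 3; inp 4; inp 5; inp 6; inp 7] inp.
  by split=> // -[|[|[|[|[|[|[|[|]]]]]]]].
rewrite /evacuate /climb /descend.
eapply (@runs_weaken _ _ _ _ post post); [do 6 step_regs| |by []].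
  have [z zE] : exists z, 8 * n + 13 * m = z by exists (8 * n + 13 * m).
  normalize_regs [:: 5 * n + 8 * m; z; inp 2; inp 3; inp 4; inp 5; inp 6; inp 7] inp.
    by congr [:: _, _ & _]; lia.
    by [].
  do 15 step_regs.
  pose h := upd (upd (upd (upd (upd (upd inp z (inp 2)) (z + 1) (inp 3)) (z + 2)
    (inp 4)) (z + 3) (inp 5)) (z + 4) (inp 6)) (z + 5) (inp 7).
  normalize_regs [:: 5 * n + 8 * m; z; 5; z; inp 4; inp 5; inp 6; inp 7] h.
    by congr [:: _, _, _, _ & _]; lia.
    by move=> a _; rewrite /h -!addnA.
  have hz j : j < 6 -> h (z + j) = inp (2 + j).
    by move: j => [|[|[|[|[|[|j]]]]]] // _; rewrite /h; updsimp.
  have ho a : a < z \/ z + 6 <= a -> h a = inp a.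
    by move=> ha; rewrite /h; updsimp.
  clearbody h; do 6 step_regs.
  apply: (hP _ z h _ _ _ _ _ zE _ hz); last by move=> a _; apply: ho.
  lazymatch goal with rs : regs _ _ _ |- _ => apply: (regs_eq rs) => // end.
  by congr [:: _, _ & _]; lia.
by lia.
Qed.

Lemma runs_skip s (post : memory -> Prop) : post s -> runs Skip s 1 post.
Proof. by move=> p; apply: (runs_exec (exec_skip s)). Qed.

(** Cell [i] moves to [B + 2 i]. All sources lie below [B] and all targets above, so nothing is
    overwritten before it is read. *)
Lemma spread_loop (inp h0 : nat -> nat) (n m z B c : nat) s h x6 x7 :
  c + 8 < B -> regs s [:: n; m; 1; z; B; c; x6; x7] h ->
  (forall a, 8 <= a < B -> h a = h0 a) ->
  (forall a, 8 <= a < c + 8 -> h0 a = inp a) ->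
  (forall i, h (B.+1 + (i + i)) = 0) ->
  (forall i, c + 8 <= i -> h (B + (i + i)) = inp i) ->
  runs (While 5 (Defs.Sub 5 5 2 ;; Const 7 8 ;; Add 7 7 5 ;; Fetch 6 7 ;;
           Add 7 7 7 ;; Add 7 7 4 ;; Store 7 6 ;; Skip)) s (9 * c + 1)
    (fun s' => exists h' x6' x7',
      [/\ regs s' [:: n; m; 1; z; B; 0; x6'; x7'] h',
          forall a, 8 <= a < B -> h' a = h0 a,
          forall i, h' (B.+1 + (i + i)) = 0 &
          forall i, 8 <= i -> h' (B + (i + i)) = inp i]).
Proof.
elim: c s h x6 x7 => [|c IH] s h x6 x7 cB rs hh hi hodd heven.
  apply: (runs_exec (exec_while_stop _ _)) => //; first by rewrite (proj1 rs).
  by exists h, x6, x7.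
set body := _ ;; _; set post := fun s' => _.
have [t [s1 [e1 t1 [h1 [y6 [y7 [r1 q1 q2 q3]]]]]]] :
    runs body s 8 (fun s' => exists h1 y6 y7,
      [/\ regs s' [:: n; m; 1; z; B; c; y6; y7] h1,
          forall a, 8 <= a < B -> h1 a = h0 a,
          forall i, h1 (B.+1 + (i + i)) = 0 &
          forall i, c + 8 <= i -> h1 (B + (i + i)) = inp i]).
  rewrite /body; do 7 step_regs; apply: runs_skip.
  eexists; eexists; eexists; split.
  - by apply: (regs_eq rs0) => //; rewrite subn1.
  - by move=> a ha; rewrite -hh //; updsimp.
  - by move=> i; rewrite -(hodd i); updsimp.
  - move=> i ci; rewrite /upd; case: eqP => ei.
      by rewrite hh ?hi ?subn1 /=; try lia; congr inp; lia.
    by apply: heven; lia.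
have [||u [s2 [e2 t2 p2]]] := IH s1 h1 y6 y7 _ r1 q1 _ q2 q3.
- lia.
- by move=> a ha; apply: hi; lia.
exists (t + u).+1, s2; split => //; last by lia.
by apply: exec_while_loop e1 e2; rewrite (proj1 rs).
Qed.

(** Names the memory after [j] cells have arrived, which keeps the eight final stores from unfolding
    into nested updates. *)
Fixpoint write_evens (B : nat) (f h : nat -> nat) (j : nat) : nat -> nat :=
  if j is j'.+1 then upd (write_evens B f h j') (B + (j' + j')) (f j') else h.

Lemma write_evens_even B f h j i :
  write_evens B f h j (B + (i + i)) = if i < j then f i else h (B + (i + i)).
Proof.
elim: j => [|j IH] //=; rewrite /upd IH; case: eqP => e.
  have -> : i = j by lia.
  by rewrite ltnSn.
by have -> : (i < j.+1) = (i < j) by lia.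
Qed.

Lemma write_evens_odd B f h j i :
  write_evens B f h j (B.+1 + (i + i)) = h (B.+1 + (i + i)).
Proof. by elim: j => [|j IH] //=; rewrite /upd IH; case: eqP => // e; lia. Qed.

Lemma write_evens_low B f h j a : a < B -> write_evens B f h j a = h a.
Proof. by move=> aB; elim: j => [|j IH] //=; rewrite /upd IH; case: eqP => // e; lia. Qed.

Lemma move_cell_runs (inp h : nat -> nat) n m z B j x6 s P T post :
  8 <= z -> z + j < B -> h (z + j) = inp (2 + j) ->
  regs s [:: n; m; 1; z + j; B; 2; x6; B + (j.+1 + j.+1)]
    (write_evens B inp h (2 + j)) ->
  (forall s, regs s [:: n; m; 1; z + j.+1; B; 2; inp (2 + j); B + (j.+2 + j.+2)]
    (write_evens B inp h (3 + j)) -> runs P s T post) ->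
  runs (move_cell P) s (4 + T) post.
Proof.
move=> z8 zB hz rs hP; rewrite /move_cell -[4 + T]/(1 + (1 + (1 + (1 + T)))).
have wz : write_evens B inp h (2 + j) (z + j) = inp (2 + j).
  by rewrite write_evens_low.
have {hP} : forall s, regs s
    [:: n; m; 1; z + j.+1; B; 2; inp (2 + j); B + (j.+2 + j.+2)]
    (upd (write_evens B inp h (2 + j)) (B + (j.+2 + j.+2)) (inp (2 + j))) ->
    runs P s T post by exact: hP.
move: (write_evens _ _ _ _) rs wz => w rs wz hP.
do 4 step_regs; apply: hP.
lazymatch goal with r : regs _ _ _ |- _ => apply: (regs_eq r); clear r end.
  by rewrite wz; congr [:: _; _; _; _; _; _; _; _]; lia.
by move=> a _; rewrite wz; congr (upd _ _ _ a); lia.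
Qed.

Lemma relocate_input_runs (inp : nat -> nat) (n m K b V : nat) :
  inp 0 = n -> inp 1 = m -> 0 < n -> 0 < m ->
  (forall i, 3 * m + 2 <= i -> inp i = 0) ->
  runs (relocate_input K b) inp (100 + 27 * m) (fun s => exists B v,
    K <= B /\ represents inp V B (n + m + b) (v, [::]) s).
Proof.
move=> i0 i1 n0 m0 iL; set post := fun s => _.
suff /runs_weaken : runs (relocate_input K b) inp
    (27 + (7 + (9 * (3 * m - 6) + 1 + 36))) post.
  by apply => //; lia.
apply: (evacuate_runs i0 i1 n0 m0) => s z h x2 x4 x5 x6 x7 zE rs hz ho.
rewrite /spread; do 7 step_regs.
pose B := K + 6 + z.
normalize_regs [:: n; m; 1; z; B; 3 * m - 6; x6; x7] h.
- by congr [:: _, _, _, _, _, _ & _]; lia.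
- by [].
apply: runs_seq.
  lazymatch goal with r0 : regs _ _ _ |- _ =>
    apply: (spread_loop (inp := inp) (h0 := h) _ r0) => //; clear r0 end.
  - by rewrite /B; lia.
  - by move=> a ha; apply: ho; lia.
  - by move=> i; rewrite ho ?iL // /B; lia.
  - by move=> i hi; rewrite ho ?iL // /B; lia.
lazymatch goal with r0 : regs _ _ _ |- _ => clear r0 end.
move=> t [h' [y6 [y7 [rt q1 q2 q3]]]].
have hz' j : j < 6 -> h' (z + j) = inp (2 + j).
  by move=> hj; rewrite q1 ?hz // /B; lia.
do 4 step_regs.
normalize_regs [:: n; m; 1; z + 0; B; 2; y6; B + (1 + 1)] (write_evens B inp h' 2).
- by congr [:: _; _; _; _; _; _; _; _]; lia.
- by move=> a _; rewrite /= i0 i1; congr (upd (upd _ _ _) _ _ a); lia.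
have zB j : j < 6 -> z + j < B by rewrite /B; lia.
have z8 : 8 <= z by lia.
do 6 (lazymatch goal with r : regs _ _ _ |- _ =>
  eapply move_cell_runs; [exact z8| | |exact r|]; clear r end;
  [by apply: zB|by apply: hz'|move=> ? ?]).
do 7 step_regs; apply: runs_skip.
lazymatch goal with r : regs ?s _ _ |- _ => case: r => rl rh; exists B, (fun x => s (4 + x)) end.
have KB : 8 <= B by rewrite /B; lia.
split; first by rewrite /B; lia.
split=> [||||x xV|i|i] /=.
- by rewrite rl.
- by rewrite rl.
- by rewrite rl //=; lia.
- by rewrite rl //= addn1.
- by [].
- rewrite rh; last lia.
  have := write_evens_even B inp h' 8 i; case: (ltnP i 8) => hi E.
    exact: E.
  by rewrite -(q3 i hi); apply: E.
- rewrite rh; last lia.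
  by rewrite nth_nil; apply: etrans (write_evens_odd B inp h' 8 i) (q2 i).
Qed.

(** * Minimal dominating sets of graphs covered by two cliques *)

(** Closed adjacency, loops included: a vertex dominating itself is then no separate case. *)
Definition clique_rel (T : finType) (A : pred T) (r : rel T) : rel T :=
  fun u v => if A u == A v then true else if A u then r u v else r v u.

Definition two_cliques (T : finType) (A : pred T) (r : rel T) : rel T :=
  fun u v => (u != v) && clique_rel A r u v.

Section TwoCliques.
Variables (T : finType) (A : pred T) (r : rel T).
Local Notation cl := (clique_rel A r).
Local Notation e := (two_cliques A r).

Lemma clique_rel_sym : symmetric cl.
Proof. by move=> u v; rewrite /clique_rel eq_sym; case: (A u) (A v) => -[]. Qed.

Lemma two_cliques_sym : symmetric e.
Proof. by move=> u v; rewrite /two_cliques eq_sym clique_rel_sym. Qed.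

Lemma two_cliques_irr : irreflexive e.
Proof. by move=> u; rewrite /two_cliques eqxx. Qed.

Lemma cl_same u v : A u = A v -> cl u v.
Proof. by rewrite /clique_rel => ->; rewrite eqxx. Qed.

Lemma cl_across a b : A a -> ~~ A b -> cl b a = r a b.
Proof. by rewrite /clique_rel => -> /negPf ->. Qed.

Lemma dominatingP (D : {set T}) :
  reflect (forall u, exists2 w, w \in D & cl u w) (dominating e D).
Proof.
apply: (iffP forallP) => h u.
  have /orP[uD|/existsP[w /andP[wD /andP[_ uw]]]] := h u.
    by exists u => //; apply: cl_same.
  by exists w.
have [w wD uw] := h u; have [->|uw'] := eqVneq u w; first by rewrite wD.
by apply/orP; right; apply/existsP; exists w; rewrite wD /two_cliques uw'.
Qed.

(** Domination passes to supersets, so minimality only concerns the removal of single members, and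
    removing [v] undominates exactly the private neighbours of [v]. *)
Lemma upper_dominatingP (D : {set T}) :
  upper_dominating e D <->
  dominating e D /\
  forall v, v \in D -> exists2 u, cl u v & forall w, w \in D -> cl u w -> w = v.
Proof.
split=> [/minsetP[dD mD]|[dD pD]].
  split=> // v vD.
  have : ~~ dominating e (D :\ v).
    apply/negP => /mD /(_ (subD1set _ _)) eD.
    by move: vD; rewrite -eD !inE eqxx.
  move=> /forallPn[u]; rewrite negb_or => /andP[uD /existsPn nu].
  have pu w : w \in D -> cl u w -> w = v.
    move=> wD uw; apply/eqP; apply: contraTT uw => wv.
    have := nu w; rewrite !inE wv wD /= /two_cliques negb_and negbK.
    by case: eqP => // uw; move: uD; rewrite !inE uw wv wD.
  have /dominatingP/(_ u)[w wD uw] := dD.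
  by exists u => //; rewrite -(pu w).
apply/minsetP; split=> // D' /dominatingP dD' sD'.
apply/eqP; rewrite finset.eqEsubset sD'; apply/fintype.subsetP => v vD.
have [u _ pu] := pD v vD; have [w wD' uw] := dD' u.
by rewrite -(pu w) // (fintype.subsetP sD').
Qed.

Variable K : nat.
Hypothesis K_gt2 : 2 < K.

(** Any single member dominates the clique [A], so only rows need care. Private rows also make the
    [d j] distinct, which gives the size. *)
Lemma two_cliques_complete (d : nat -> T) :
  (forall j, j < K -> A (d j)) ->
  (forall b, ~~ A b -> exists2 j, j < K & r (d j) b) ->
  (forall j, j < K -> exists b, [/\ ~~ A b, r (d j) b &
        forall i, i < K -> i != j -> ~~ r (d i) b]) ->
  has_upper_dominating e K.
Proof.
move=> dA dB dP; pose d' (j : 'I_K) := d j.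
have dinj : injective d'.
  move=> i j dij; apply/eqP; apply: contraPT dij => ij eij.
  have [b [_ rb]] := dP j (ltn_ord j); move=> /(_ i (ltn_ord i) ij).
  by rewrite -/(d' i) eij rb.
exists [set d' j | j : 'I_K]; last by rewrite card_imset // card_ord.
apply/upper_dominatingP; split.
  apply/dominatingP => u; case Au: (A u).
    have K0 : 0 < K by move: K_gt2; lia.
    by exists (d' (Ordinal K0)); [apply: imset_f|apply: cl_same; rewrite Au dA].
  have [j jK rj] := dB u (negbT Au); exists (d' (Ordinal jK)).
    exact: imset_f.
  by rewrite cl_across ?Au // dA.
move=> _ /imsetP[j _ ->]; have [b [nAb rb pb]] := dP j (ltn_ord j).
exists b; first by rewrite cl_across // dA.
move=> _ /imsetP[i _ ->]; rewrite cl_across ?dA // => rib.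
apply/eqP; apply: contraTT rib => nij; apply: pb => //.
by apply: contraNneq nij => ij; rewrite /d' ij.
Qed.

Variables (col : T -> nat) (x0 : T).
Hypothesis Ax0 : A x0.
Hypothesis r0 : forall b, r x0 b = false.
Hypothesis col_lt : forall a b, A a -> r a b -> col a < K.
Hypothesis chain : forall a a', A a -> A a' -> col a = col a' ->
  (forall b, r a b -> r a' b) \/ (forall b, r a' b -> r a b).

(** One vertex in each clique would dominate everything, so [K > 2] confines the set to one clique;
    it is [A], as only [A] dominates [x0]. Of two vertices in a column, the one with the smaller
    neighbourhood has no private row, so the set is a transversal of the [K] columns. *)
Lemma two_cliques_sound : has_upper_dominating e K ->
  exists d : nat -> T,
  [/\ forall j, j < K -> A (d j) /\ col (d j) = j,
      forall b, ~~ A b -> exists2 j, j < K & r (d j) b &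
      forall j, j < K -> exists2 b, r (d j) b &
        forall i, i < K -> i != j -> ~~ r (d i) b].
Proof.
move=> [D /upper_dominatingP[/dominatingP dD pD] KD].
have [a0 a0D Aa0] : exists2 a, a \in D & A a.
  have [w wD] := dD x0; rewrite /clique_rel Ax0 r0.
  by case Aw: (A w) => //; exists w.
have DA v : v \in D -> A v.
  move=> vD; apply: contraTT KD => nAv; rewrite -ltnNge.
  apply: leq_ltn_trans K_gt2.
  apply: (@leq_trans #|[set a0; v]|); last by rewrite cards2; case: eqP.
  apply/subset_leq_card/fintype.subsetP => w wD; rewrite !inE.
  have [u _ pu] := pD w wD; case Au: (A u).
    by rewrite (pu a0) ?eqxx //; apply: cl_same; rewrite Aa0.
  by rewrite (pu v) ?eqxx ?orbT //; apply: cl_same; rewrite Au (negPf nAv).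
have priv v : v \in D ->
    exists u, [/\ ~~ A u, r v u & forall w, w \in D -> r w u -> w = v].
  move=> vD; have [u uv pu] := pD v vD.
  (* A private neighbour inside [A] would be adjacent or equal to every member, leaving only one
     member. *)
  have nAu : ~~ A u.
    apply/negP => Au.
    have : D \subset [set v].
      apply/fintype.subsetP => w wD; rewrite inE; apply/eqP/pu => //.
      by apply: cl_same; rewrite Au DA.
    move/subset_leq_card; rewrite cards1 => D1; have := leq_trans KD D1.
    by move: K_gt2; lia.
  exists u; split=> //; first by rewrite -cl_across // DA.
  by move=> w wD; rewrite -(cl_across (DA w wD) nAu); apply: pu.
have colD v : v \in D -> col v < K.
  by move=> vD; have [u [_ vu _]] := priv v vD; apply: col_lt vu; apply: DA.
have inj : {in D &, injective col}.
  move=> v w vD wD cvw.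
  have [h|h] := chain (DA v vD) (DA w wD) cvw.
    by have [u [_ /h wu pu]] := priv v vD; rewrite (pu w).
  by have [u [_ /h vu pu]] := priv w wD; rewrite (pu v).
have surj j : j < K -> exists2 v, v \in D & col v = j.
  move=> jK; pose s := [seq col v | v <- enum D].
  have us : uniq s.
    rewrite map_inj_in_uniq ?enum_uniq // => v w.
    by rewrite !mem_enum; apply: inj.
  have ss : {subset s <= iota 0 K}.
    move=> i /mapP[v]; rewrite mem_enum => vD ->.
    by rewrite mem_iota /= add0n colD.
  have sK : size (iota 0 K) <= size s by rewrite size_iota size_map -cardE.
  have [_ es] := uniq_min_size us ss sK.
  have : j \in s by rewrite es mem_iota.
  by move=> /mapP[v]; rewrite mem_enum => vD ->; exists v.
have surj' j : exists v, j < K -> v \in D /\ col v = j.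
  have [jK|] := boolP (j < K); last by exists x0.
  by have [v vD <-] := surj j jK; exists v.
have [d hd] := choice surj'.
have dE v : v \in D -> d (col v) = v.
  by move=> vD; have [dD' ec] := hd _ (colD v vD); apply: inj.
exists d; split.
- by move=> j jK; have [jD ->] := hd j jK; rewrite DA.
- move=> b nAb; have [w wD bw] := dD b.
  exists (col w); first exact: colD.
  by rewrite dE // -cl_across // DA.
- move=> j jK; have [jD cj] := hd j jK.
  have [u [nAu ru pu]] := priv _ jD; exists u => // i iK.
  have [iD ci] := hd i iK; apply: contraNN => ri.
  by rewrite -ci -cj (pu (d i)).
Qed.

End TwoCliques.

(** * The graph of a formula *)

(* Vertices are numbers below [(m + 3k + 1) Q^3], read as a leading part [top] and
   three digits in base [Q]. *)
Definition dig1 (Q x : nat) := x %% Q.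
Definition dig2 (Q x : nat) := x %/ Q %% Q.
Definition dig3 (Q x : nat) := x %/ Q %/ Q %% Q.
Definition top (Q x : nat) := x %/ Q %/ Q %/ Q.
Definition vertex (Q c a3 a2 a1 : nat) := ((c * Q + a3) * Q + a2) * Q + a1.

Lemma vertex_digits Q c a3 a2 a1 : a3 < Q -> a2 < Q -> a1 < Q ->
  [/\ dig1 Q (vertex Q c a3 a2 a1) = a1, dig2 Q (vertex Q c a3 a2 a1) = a2,
      dig3 Q (vertex Q c a3 a2 a1) = a3 & top Q (vertex Q c a3 a2 a1) = c].
Proof.
move=> h3 h2 h1; have Q0 : 0 < Q by lia.
have dE y a : a < Q -> (y * Q + a) %/ Q = y.
  by move=> h; rewrite divnMDl // divn_small ?addn0.
rewrite /dig1 /dig2 /dig3 /top /vertex.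
by split; rewrite ?dE // modnMDl modn_small.
Qed.

Lemma vertex_lt Q c a3 a2 a1 C : a3 < Q -> a2 < Q -> a1 < Q -> c < C ->
  vertex Q c a3 a2 a1 < C * Q ^ 3.
Proof.
move=> h3 h2 h1 hc; rewrite /vertex !expnS expn0 muln1 !mulnA.
have step x y z : x < Q -> y < z -> y * Q + x < z * Q.
  move=> hx hy; apply: (@leq_trans (y.+1 * Q)); first by rewrite mulSn; lia.
  by rewrite leq_mul2r hy orbT.
by do 3! apply: (step) => //.
Qed.

Lemma top_lt Q C x : x < C * Q ^ 3 -> top Q x < C.
Proof.
have [->|Q0] := posnP Q; first by rewrite exp0n // muln0.
by rewrite /top !ltn_divLR // !expnS expn0 muln1 !mulnA.
Qed.

(* Variable [v] is bit [v / k] of the value of group [v mod k].  Column [j] is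
   block [s = j / k] of group [g = j mod k]: block 0 holds the value of the group,
   block 1 the value counted downwards from [Q - 1], block 2 checks that the two
   agree, and all other columns are isolated from the rows. *)
Definition literal_hit (k Q s g b a l : nat) : bool :=
  ((s == 0) && (((a %/ 2 ^ (l %/ 2 %/ k)) %% 2 == l %% 2) ||
                ((g == l %/ 2 %% k) && (a < b)))) ||
  ((s == 1) && ((g == l %/ 2 %% k) && (Q - a <= b))).

(** The digits of a clause row are the guesses for the groups of its literals. A guess satisfying
    its literal makes the row visible to all of block 0. A wrong guess [a] shows as [a < b] in the
    value column or, since [b < a] means [Q - a <= Q - 1 - b], in the reversed one. *)
Definition clause_hit (k Q : nat) (inp : nat -> nat) (s g b y : nat) : bool :=
  [|| literal_hit k Q s g b (dig1 Q y) (inp (2 + top Q y * 3)),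
      literal_hit k Q s g b (dig2 Q y) (inp (3 + top Q y * 3)) |
      literal_hit k Q s g b (dig3 Q y) (inp (4 + top Q y * 3))].

(** For the choices [b] and [b'] of a group, the rows of type 0 force [b + b' >= Q - 1], and
    threshold 0 is private to the value column. Type 1 is private to the reversed column. Type 2 is
    the only source of private rows for the check column, and forces [b + b' <= Q - 1]. *)
Definition check_hit (k m Q s g b y : nat) : bool :=
  let ty := (top Q y - m) %/ k in
  let th := dig1 Q y in
  (g == (top Q y - m) %% k) &&
  ([|| (ty == 0) && (((s == 0) && (th <= b)) || ((s == 1) && (Q - th <= b))),
       (ty == 1) && (s == 1) |
       (ty == 2) && [|| (s == 0) && (th < b), (s == 1) && (Q - th <= b) |
                        s == 2]]).

Definition hit (k m Q : nat) (inp : nat -> nat) (j b y : nat) : bool :=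
  if top Q y < m then clause_hit k Q inp (j %/ k) (j %% k) b y
  else check_hit k m Q (j %/ k) (j %% k) b y.

Definition in_col (k m Q x : nat) : bool := top Q x == m + 3 * k.

Definition cross (k m Q : nat) (inp : nat -> nat) (x y : nat) : bool :=
  hit k m Q inp (dig2 Q x) (dig1 Q x) y.

Definition sat_graph (k m Q : nat) (inp : nat -> nat) (N : nat) : rel 'I_N :=
  two_cliques (fun x : 'I_N => in_col k m Q x)
              (fun x y : 'I_N => cross k m Q inp x y).

Lemma literal_hit_mono k Q s g b b' a l : b <= b' ->
  literal_hit k Q s g b a l -> literal_hit k Q s g b' a l.
Proof.
rewrite /literal_hit => bb.
by move=> /orP[/andP[-> /orP[->//|/andP[-> h]]]|/andP[-> /andP[-> h]]];
  rewrite ?(leq_trans h bb) ?orbT.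
Qed.

(** Makes the neighbourhoods within a column comparable. *)
Lemma hit_mono k m Q inp j b b' y : b <= b' ->
  hit k m Q inp j b y -> hit k m Q inp j b' y.
Proof.
move=> bb; rewrite /hit; case: ifP => _.
  by move=> /or3P[] /(literal_hit_mono bb) h; rewrite /clause_hit h ?orbT.
rewrite /check_hit /= => /andP[-> h] /=.
case/or3P: h => [/andP[-> /orP[/andP[-> h]|/andP[-> h]]]|->|/andP[->]].
- by rewrite (leq_trans h bb).
- by rewrite (leq_trans h bb) ?orbT.
- by rewrite !orbT.
- case/or3P=> [/andP[-> h]|/andP[-> h]|->];
    by rewrite ?(leq_trans h bb) ?orbT.
Qed.

(** Columns from [3 k] on supply the vertex [x0] without row neighbours that [two_cliques_sound]
    asks for. *)
Lemma hit_block k m Q inp j b y : 0 < k -> hit k m Q inp j b y -> j < 3 * k.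
Proof.
move=> k0 h; rewrite -ltn_divLR //; move: h.
by rewrite /hit /clause_hit /check_hit /literal_hit; move: (j %/ k) => [|[|[|s]]] //;
  case: ifP => _; rewrite ?andbF.
Qed.

Lemma bits_exist (f : nat -> bool) L :
  exists2 a, a < 2 ^ L & forall p, p < L -> (a %/ 2 ^ p) %% 2 = f p.
Proof.
elim: L f => [|L IH] f; first by exists 0.
have [a aL ha] := IH (fun p => f p.+1).
exists (a * 2 + f 0); first by rewrite expnS; case: (f 0); lia.
move=> [|p] pL; first by rewrite expn0 divn1 modnMDl modn_small //; case: (f 0).
rewrite expnS divnMA divnMDl // [_ %/ 2]divn_small ?addn0 ?ha //.
by case: (f 0).
Qed.

Lemma sat_input_clause n (phi : cnf3 n) cl0 l0 c i : c < size phi -> i < 3 ->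
  nth 0 (sat_input phi) (2 + i + c * 3) =
  literal_code (nth l0 (tval (nth cl0 phi c)) i).
Proof.
rewrite /sat_input -addnA /=; elim: phi c => [|cl phi IH] [|c] //= hc hi.
  by rewrite addn0 nth_cat size_map size_tuple hi (nth_map l0) ?size_tuple.
rewrite nth_cat size_map size_tuple mulSn.
have -> : (i + (3 + c * 3) < 3) = false by lia.
have -> : i + (3 + c * 3) - 3 = i + c * 3 by lia.
exact: IH.
Qed.

Lemma literal_code_var n (l : literal n) : literal_code l %/ 2 = l.1.
Proof. by rewrite /literal_code -muln2 divnMDl // divn_small ?addn0 //; case: l.2. Qed.

Lemma literal_code_sign n (l : literal n) : literal_code l %% 2 = l.2.
Proof. by rewrite /literal_code -muln2 modnMDl modn_small //; case: l.2. Qed.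

(** * Correctness of the reduction *)

Section SatGraph.
Variables (n : nat) (phi : cnf3 n) (k Q : nat).
Local Notation m := (size phi).
Local Notation inp := (nth 0 (sat_input phi)).
Hypothesis k_gt0 : 0 < k.
Hypothesis Qk : 3 * k < Q.
Local Notation N := ((m + 3 * k + 1) * Q ^ 3).
Local Notation graph := (sat_graph k m Q inp (N := N)).

Let block0 g : g < k -> (g %/ k = 0) * (g %% k = g).
Proof. by move=> h; rewrite divn_small ?modn_small. Qed.
Let block1 g : g < k -> ((k + g) %/ k = 1) * ((k + g) %% k = g).
Proof. by move=> h; rewrite -[X in X + g]mul1n divnMDl // modnMDl !block0. Qed.
Let block2 g : g < k -> ((2 * k + g) %/ k = 2) * ((2 * k + g) %% k = g).
Proof. by move=> h; rewrite divnMDl // modnMDl !block0. Qed.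

Let mkP c a3 a2 a1 : a3 < Q -> a2 < Q -> a1 < Q -> c < m + 3 * k + 1 ->
  exists y : 'I_N,
    [/\ dig1 Q y = a1, dig2 Q y = a2, dig3 Q y = a3 & top Q y = c].
Proof.
move=> h3 h2 h1 hc; exists (Ordinal (vertex_lt h3 h2 h1 hc)) => /=.
exact: vertex_digits.
Qed.

Lemma sat_graph_sound : has_upper_dominating graph (3 * k) -> satisfiable phi.
Proof.
have Q0 : 0 < Q by lia.
(* As [3 k < Q], the digit for the column can take the value [3 k]. *)
have [|||x0 [_ x02 _ x0t]] := @mkP (m + 3 * k) 0 (3 * k) 0 _ Qk; rewrite ?Q0 //.
  by rewrite addn1.
have K2 : 2 < 3 * k by lia.
move=> /(two_cliques_sound K2 (col := fun x : 'I_N => dig2 Q x) (x0 := x0)).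
case.
- by rewrite /in_col x0t.
- move=> y; apply/negP => /(hit_block k_gt0); rewrite x02; lia.
- by move=> a b _; apply: hit_block.
- move=> a a' _ _ cc; rewrite /cross cc.
  have [h|/ltnW h] := leqP (dig1 Q a) (dig1 Q a'); [left|right] => b;
    exact: hit_mono.
move=> d [dA dB dP]; pose b j := dig1 Q (d j).
have bQ j : b j < Q by rewrite ltn_mod.
have crossE j y : j < 3 * k -> cross k m Q inp (d j) y = hit k m Q inp j (b j) y.
  by move=> hj; rewrite /cross; have [_ ->] := dA j hj.
have opp g : g < k -> b g = Q - 1 - b (k + g).
  move=> hg; apply/eqP; rewrite eqn_leq; apply/andP; split.
    (* Upper bound on [b g]: the private row of the check column is of type 2 and is missed by both
       value columns. *)
    have hj : 2 * k + g < 3 * k by lia.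
    have [y] := dP _ hj; rewrite crossE // /hit.
    case: ifP => ty.
      by rewrite /clause_hit /literal_hit !(block2 hg).
    rewrite /check_hit !(block2 hg) /= => /andP[/eqP hh].
    rewrite !andbF /= andbT => /eqP t2 pr.
    have g3 : g < 3 * k by lia.
    have kg3 : k + g < 3 * k by lia.
    have := pr g g3; rewrite crossE // /hit ty /check_hit !(block0 hg) /=.
    rewrite -hh t2 eqxx /= orbF => /(_ _) h1.
    have := pr _ kg3; rewrite crossE // /hit ty /check_hit !(block1 hg) /=.
    rewrite -hh t2 eqxx /= orbF => /(_ _) h2.
    have {}h1 : ~~ (dig1 Q y < b g) by apply: h1; lia.
    have {}h2 : ~~ (Q - dig1 Q y <= b (k + g)) by apply: h2; lia.
    by move: h1 h2 (bQ g) (bQ (k + g)); lia.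
  (* Lower bound on [b g]: in the type 0 row with this threshold the reversed column falls short by
     one, so the value column must see the row. *)
  have hQ : Q - 1 - b (k + g) < Q by have := bQ (k + g); lia.
  have [|y [y1 y2 y3 yt]] := @mkP (m + g) 0 0 _ Q0 Q0 hQ; first lia.
  have [|j hj] := dB y.
    by rewrite /in_col yt; apply/eqP; lia.
  rewrite crossE // /hit yt ltnNge leq_addr /= /check_hit yt addKn !(block0 hg) /=.
  rewrite orbF y1 => /andP[/eqP jk /orP[/andP[/eqP s0]|/andP[/eqP s1]]].
    by have -> : j = g by rewrite (divn_eq j k) s0 jk.
  have -> : j = k + g by rewrite (divn_eq j k) s1 jk mul1n.
  by have := bQ (k + g); lia.
pose alpha (v : 'I_n) : bool := (b (v %% k) %/ 2 ^ (v %/ k)) %% 2 == 1.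
(* For the true value as guess, neither strict comparison can succeed, so a hit means that the
   literal holds. *)
have hitP (l : literal n) j : j < 3 * k ->
    literal_hit k Q (j %/ k) (j %% k) (b j) (b (l.1 %% k)) (literal_code l) ->
    alpha l.1 == l.2.
  move=> hj; rewrite /literal_hit literal_code_var literal_code_sign.
  have lk : l.1 %% k < k by rewrite ltn_mod.
  move=> /orP[/andP[/eqP s0 /orP[/eqP|/andP[/eqP jk]]]|/andP[/eqP s1 /andP[/eqP jk]]].
  - by rewrite /alpha => ->; case: l.2.
  - have -> : j = l.1 %% k by rewrite (divn_eq j k) s0 jk.
    by rewrite ltnn.
  - have -> : j = k + l.1 %% k by rewrite (divn_eq j k) s1 jk mul1n.
    by rewrite opp //; have := bQ (k + l.1 %% k); lia.
exists alpha; apply/allP => cl clphi.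
have ci : index cl phi < m by rewrite index_mem.
have ncl : nth cl phi (index cl phi) = cl by rewrite nth_index.
case: cl clphi ci ncl => -[|l1 [|l2 [|l3 []]]] // sz clphi ci ncl.
have [||||y [y1 y2 y3 yt]] := @mkP (index (Tuple sz) phi)
  (b (l3.1 %% k)) (b (l2.1 %% k)) (b (l1.1 %% k)); rewrite ?bQ //; first lia.
have [|j hj] := dB y; first by rewrite /in_col yt; apply/eqP; lia.
rewrite crossE // /hit yt ci /clause_hit y1 y2 y3 yt.
have sE i : i < 3 -> inp (2 + i + index (Tuple sz) phi * 3) =
    literal_code (nth l1 [:: l1; l2; l3] i).
  by move=> hi; rewrite (sat_input_clause (Tuple sz) l1) // ncl.
rewrite (sE 0) // (sE 1) // (sE 2) //=.
by case/or3P => /(hitP _ j hj) ->; rewrite ?orbT.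
Qed.

(** A group has at most [n %/ k + 1] variables. *)
Hypothesis Qn : 2 ^ (n %/ k).+1 <= Q.

Lemma sat_graph_complete : satisfiable phi -> has_upper_dominating graph (3 * k).
Proof.
have Q0 : 0 < Q by lia.
move=> [alpha /allP sat].
(* Bit positions beyond the last variable read [false]. *)
pose bits g p := if insub (p * k + g) is Some v then alpha v else false.
have hv g : exists a, a < Q /\
    forall p, p < (n %/ k).+1 -> (a %/ 2 ^ p) %% 2 = bits g p.
  have [a aQ ha] := bits_exist (bits g) (n %/ k).+1.
  by exists a; split=> //; apply: leq_trans Qn.
have [a ha] := choice hv.
have aQ g : a g < Q by have [] := ha g.
have abit (v : 'I_n) : (a (v %% k) %/ 2 ^ (v %/ k)) %% 2 = alpha v.
  have [_ ->] := ha (v %% k); last by rewrite ltnS leq_div2r // ltnW.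
  by rewrite /bits -divn_eq valK.
(* What a check column sees is independent of the choice in it, so 0 is as good as any. *)
pose b j := if j %/ k == 0 then a (j %% k)
            else if j %/ k == 1 then Q - 1 - a (j %% k) else 0.
have bQ j : b j < Q by rewrite /b; have := aQ (j %% k); case: ifP => _; [|case: ifP => _]; lia.
have hd j : exists x : 'I_N, j < 3 * k ->
    [/\ in_col k m Q x, dig2 Q x = j & dig1 Q x = b j].
  have [hj|_] := boolP (j < 3 * k); last first.
    by have [|x _] := @mkP (m + 3 * k) 0 0 0 Q0 Q0 Q0; [lia|exists x].
  have [||x [x1 x2 _ xt]] := @mkP (m + 3 * k) 0 j (b j) Q0 _ (bQ j).
  - lia.
  - lia.
  - by exists x; rewrite /in_col xt.
have [d hd'] := choice hd.
have crossE j y : j < 3 * k -> cross k m Q inp (d j) y = hit k m Q inp j (b j) y.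
  by move=> hj; rewrite /cross; have [_ -> ->] := hd' j hj.
have b0 g : g < k -> b g = a g by move=> hg; rewrite /b !(block0 hg).
have b1 g : g < k -> b (k + g) = Q - 1 - a g.
  by move=> hg; rewrite /b !(block1 hg).
rewrite /sat_graph; apply: (@two_cliques_complete _ _ _ _ _ d); first by lia.
- by move=> j hj; have [] := hd' j hj.
- move=> y ny.
  have yt : top Q y < m + 3 * k.
    have := top_lt (ltn_ord y); move: ny; rewrite /in_col.
    by move: (top Q y) => z; lia.
  have [ym|ym] := ltnP (top Q y) m.
    have [cl0 _] : exists cl, cl \in phi.
      have := leq_ltn_trans (leq0n _) ym.
      by case: (phi) => // cl ? _; exists cl; rewrite mem_head.
    pose cl := nth cl0 phi (top Q y).
    have /sat/hasP[l lcl al] : cl \in phi by rewrite mem_nth.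
    pose i := index l cl.
    have hi : i < 3 by rewrite -[3](size_tuple cl) index_mem.
    pose di := nth 0 [:: dig1 Q y; dig2 Q y; dig3 Q y] i.
    have li : inp (2 + i + top Q y * 3) = literal_code l.
      by rewrite (sat_input_clause cl0 l) // nth_index.
    suff [j hj lh] : exists2 j, j < 3 * k &
        literal_hit k Q (j %/ k) (j %% k) (b j) di (literal_code l).
      exists j => //; rewrite crossE // /hit ym /clause_hit.
      move: lh; rewrite -li /di; move: (i) hi => [|[|[|//]]] _ /= ->;
        by rewrite ?orbT.
    pose g := l.1 %% k.
    have gk : g < k by rewrite ltn_mod.
    (* A guess that is too small is seen by the value column, one that is too large by the reversed
       column, and a correct one satisfies the literal. *)
    have [dia|dia|dia] := ltngtP di (a g).
    + exists g; first lia.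
      rewrite !(block0 gk) /literal_hit literal_code_var -/g !eqxx b0 // dia.
      by rewrite orbT.
    + exists (k + g); first lia.
      rewrite !(block1 gk) /literal_hit literal_code_var -/g !eqxx b1 //=.
      by have := aQ g; lia.
    + exists g; first lia.
      rewrite !(block0 gk) /literal_hit literal_code_var literal_code_sign dia.
      by rewrite abit (eqP al) !eqxx.
  pose g := (top Q y - m) %% k; pose ty := (top Q y - m) %/ k.
  have gk : g < k by rewrite ltn_mod.
  have ty3 : ty < 3 by rewrite ltn_divLR //; lia.
  suff [j hj lh] : exists2 j, j < 3 * k &
      check_hit k m Q (j %/ k) (j %% k) (b j) y.
    by exists j => //; rewrite crossE // /hit ltnNge ym.
  have [t0|t0] := eqVneq ty 0.
    have [ath|ath] := leqP (dig1 Q y) (a g).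
      exists g; first lia.
      by rewrite /check_hit -/g -/ty !(block0 gk) t0 eqxx /= b0 // ath.
    exists (k + g); first lia.
    rewrite /check_hit -/g -/ty !(block1 gk) t0 eqxx /= b1 //.
    by have := aQ g; lia.
  have [t1|t1] := eqVneq ty 1.
    exists (k + g); first lia.
    by rewrite /check_hit -/g -/ty !(block1 gk) t1 eqxx.
  have t2 : ty = 2 by lia.
  exists (2 * k + g); first lia.
  by rewrite /check_hit -/g -/ty !(block2 gk) t2 eqxx.
- move=> j hj; pose g := j %% k; pose s := j %/ k.
  have gk : g < k by rewrite ltn_mod.
  have s3 : s < 3 by rewrite ltn_divLR //; lia.
  have jE : j = s * k + g by rewrite [LHS](divn_eq j k).
  pose c := m + (s * k + g).
  (* The private row of block [s] is taken of type [s]: threshold 0 is out of reach of the reversed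
     column, and threshold [a g] in type 2 is just missed by both value columns. *)
  pose th := if s == 2 then a g else 0.
  have [||y [y1 y2 y3 yt]] := @mkP c 0 0 th Q0 Q0.
  - by rewrite /th; case: ifP.
  - by rewrite /c; lia.
  have yE i : i < 3 * k -> cross k m Q inp (d i) y =
      check_hit k m Q (i %/ k) (i %% k) (b i) y.
    by move=> hi; rewrite crossE // /hit yt /c ltnNge leq_addr.
  have tyE : ((top Q y - m) %/ k = s) * ((top Q y - m) %% k = g).
    by rewrite yt /c addKn divnMDl // modnMDl divn_small // modn_small // addn0.
  exists y; split.
  + by rewrite /in_col yt /c; apply/eqP; lia.
  + rewrite yE // /check_hit !tyE -/g -/s eqxx y1 /th /=.
    by move: (s) s3 => [|[|[|//]]] _.
  + move=> i hi nij; rewrite yE // /check_hit !tyE; apply/negP => /andP[/eqP ig].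
    have iE : i = i %/ k * k + g by rewrite {1}(divn_eq i k) ig.
    have nis : i %/ k != s by apply: contraNneq nij => h; rewrite iE h -jE.
    have bE0 : i %/ k = 0 -> b i = a g by rewrite /b ig => ->.
    have bE1 : i %/ k = 1 -> b i = Q - 1 - a g by rewrite /b ig => ->.
    rewrite y1 /th; have := aQ g; move: nis bE0 bE1.
    move: (s) s3 (i %/ k) => [|[|[|//]]] _ [|[|[|i']]] //= _ B0 B1 h.
    all: rewrite ?(B0 erefl) ?(B1 erefl) //=; lia.
Qed.

End SatGraph.

(** * The program printing the graph *)

(** Truth values are the numbers 0 and 1, produced by truncated subtraction. *)
Definition eLe a b := ESub (EC 1) (ESub a b).
Definition eLt a b := eLe (EAdd (EC 1) a) b.
Definition eEq a b := ESub (EC 1) (EAdd (ESub a b) (ESub b a)).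
Definition eAnd a b := ESub (EAdd a b) (EC 1).
Definition eOr a b := ESub (EC 1) (ESub (EC 1) (EAdd a b)).

Section EvalBool.
Variables (inp v : nat -> nat).

Lemma eval_le a b : eval inp v (eLe a b) = (eval inp v a <= eval inp v b) :> nat.
Proof. by rewrite /eLe /=; case: leqP; lia. Qed.

Lemma eval_lt a b : eval inp v (eLt a b) = (eval inp v a < eval inp v b) :> nat.
Proof. by rewrite eval_le. Qed.

Lemma eval_eq a b : eval inp v (eEq a b) = (eval inp v a == eval inp v b) :> nat.
Proof. by rewrite /eEq /=; case: eqP; lia. Qed.

Lemma eval_and a b (p q : bool) : eval inp v a = p -> eval inp v b = q ->
  eval inp v (eAnd a b) = (p && q) :> nat.
Proof. by rewrite /eAnd /= => -> ->; case: p; case: q. Qed.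

Lemma eval_or a b (p q : bool) : eval inp v a = p -> eval inp v b = q ->
  eval inp v (eOr a b) = (p || q) :> nat.
Proof. by rewrite /eOr /= => -> ->; case: p; case: q. Qed.
End EvalBool.

Section Computes.
Variables (inp : nat -> nat) (M : nat).

(** Triples for commands that print nothing, whatever was printed before. Time needs no mention,
    being bounded by [ccost]. *)
Definition computes (c : cmd) (v : nat -> nat) (post : (nat -> nat) -> Prop) :=
  forall o, exists2 v', den inp M c (v, o) = (v', o) & post v'.

Lemma computes_set x e v (post : (nat -> nat) -> Prop) :
  post (upd v x (eval inp v e)) -> computes (CSet x e) v post.
Proof. by move=> h o; exists (upd v x (eval inp v e)). Qed.

Lemma computes_seq c1 c2 v (mid post : (nat -> nat) -> Prop) :
  computes c1 v mid -> (forall v', mid v' -> computes c2 v' post) ->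
  computes (CSeq c1 c2) v post.
Proof.
move=> h1 h2 o; have [v1 e1 /h2 h] := h1 o; have [v2 e2 p2] := h o.
by exists v2; rewrite //= e1.
Qed.

Lemma computes_set_seq x e c v post :
  computes c (upd v x (eval inp v e)) post ->
  computes (CSeq (CSet x e) c) v post.
Proof. by move=> h o; have [v2 e2 p2] := h o; exists v2. Qed.

Lemma computes_if e c1 c2 v post :
  (eval inp v e != 0 -> computes c1 v post) ->
  (eval inp v e = 0 -> computes c2 v post) -> computes (CIf e c1 c2) v post.
Proof. by move=> h1 h2 o /=; case: eqP => [/h2|/eqP/h1]; apply. Qed.

Lemma computes_for x e c v n (I : nat -> (nat -> nat) -> Prop) :
  eval inp v e = n -> n <= M -> I 0 v ->
  (forall i v', i < n -> I i v' -> computes c (upd v' x i) (I i.+1)) ->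
  computes (CFor x e c) v (I n).
Proof.
move=> en hM h0 hS o /=; rewrite en (minn_idPl hM).
suff : forall i, i <= n -> exists2 v',
    iteri i (fun j st => den inp M c (upd st.1 x j, st.2)) (v, o) = (v', o) & I i v'.
  by apply.
elim=> [|i IH] hi; first by exists v.
have [v1 e1 p1] := IH (ltnW hi); have [v2 e2 p2] := hS i v1 hi p1 o.
by exists v2 => //=; rewrite e1.
Qed.

Lemma computes_weaken c v (post post' : (nat -> nat) -> Prop) :
  computes c v post -> (forall v', post v' -> post' v') -> computes c v post'.
Proof. by move=> h hp o; have [v' e p] := h o; exists v' => //; apply: hp. Qed.
End Computes.

(* Variables of the printing program: 0 number of vertices, 1 base [Q], 6 and 7
   the vertices of the pair being printed, 8 and 9 the same with the column first,
   10 and 11 the leading parts of 6 and 7, 22 the result; 30 counts the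
   iterations of [cdivmod]. *)
Definition cdivmod (q r : nat) (a b : expr) : cmd :=
  CSeq (CSet r a) (CSeq (CSet q (EC 0))
    (CFor 30 (EV r)
      (CIf (eLe b (EV r))
        (CSeq (CSet r (ESub (EV r) b)) (CSet q (EAdd (EV q) (EC 1))))
        (CSet r (EV r))))).

Section Programs.
Variables (inp : nat -> nat) (M : nat).
Local Notation computes := (computes inp M).
Local Notation eval := (eval inp).

Lemma cdivmodP q r a b v av bv : q != r -> q != 30 -> r != 30 ->
  eval v a = av -> av <= M -> 0 < bv ->
  (forall v', (forall y, y \notin [:: q; r; 30] -> v' y = v y) -> eval v' b = bv) ->
  computes (cdivmod q r a b) v (fun v' =>
    [/\ v' q = av %/ bv, v' r = av %% bv &
        forall y, y \notin [:: q; r; 30] -> v' y = v y]).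
Proof.
move=> qr q30 r30 ea aM b0 eb.
apply: computes_set_seq.
apply: computes_set_seq.
rewrite ea /=; set v0 := upd _ q 0.
(* The loop runs [av] times, possibly far beyond the quotient. Until the remainder is below [bv] it
   drops by at least one per round, so after [av] rounds it is below [bv] in either case. *)
pose I i (v' : nat -> nat) := [/\ v' q * bv + v' r = av, v' r < bv \/ v' r + i <= av &
  forall y, y \notin [:: q; r; 30] -> v' y = v y].
have v0r : v0 r = av by rewrite /v0 /upd eq_sym (negPf qr) eqxx.
have I0 : I 0 v0.
  split; rewrite ?v0r ?addn0; first by rewrite /v0 /upd eqxx.
  - by right.
  - by move=> y; rewrite !inE /v0 /upd !negb_or => /and3P[/negPf-> /negPf->].
apply: (computes_weaken (computes_for (e := EV r) (I := I) v0r aM I0 _)).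
  move=> i v1 hi [h1 h2 f1]; set v2 := upd v1 30 i.
  have v2q : v2 q = v1 q by rewrite /v2 /upd (negPf q30).
  have v2r : v2 r = v1 r by rewrite /v2 /upd (negPf r30).
  have f2 y : y \notin [:: q; r; 30] -> v2 y = v y.
    move=> hy; rewrite -f1 // /v2 /upd; move: hy; rewrite !inE !negb_or.
    by case/and3P => _ _ /negPf ->.
  have ltE : eval v2 (eLe b (EV r)) = (bv <= v1 r).
    by rewrite eval_le (eb _ f2) /= v2r.
  apply: computes_if; rewrite ltE; case: leqP => //= h _.
    apply: computes_set_seq.
    apply: computes_set => /=; rewrite (eb _ f2) v2r.
    set v3 := upd v2 r _.
    have v3q : v3 q = v1 q by rewrite /v3 /upd (negPf qr).
    have v3r : v3 r = v1 r - bv by rewrite /v3 /upd eqxx.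
    split.
    - by rewrite /upd eqxx eq_sym (negPf qr) v3q v3r; move: h1 h; nia.
    - by rewrite /upd eq_sym (negPf qr) v3r; lia.
    - move=> y hy; rewrite -f2 //; move: hy; rewrite !inE !negb_or /v3 /upd.
      by case/and3P => /negPf -> /negPf ->.
  apply: computes_set => /=; rewrite v2r; split.
  - by rewrite /upd (negPf qr) eqxx -/v2 v2q.
  - by rewrite /upd eqxx; left.
  - move=> y hy; rewrite -f2 //; move: hy; rewrite !inE !negb_or /upd.
    by case/and3P => _ /negPf ->.
move=> v1 [h1 h2 f1]; have h : v1 r < bv by lia.
by rewrite -h1 divnMDl // modnMDl divn_small // modn_small // addn0.
Qed.

Lemma cdivmodV q r a x v av bv : uniq [:: q; r; 30] -> x \notin [:: q; r; 30] ->
  v x = bv -> 0 < bv -> eval v a = av -> av <= M ->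
  computes (cdivmod q r a (EV x)) v (fun v' =>
    [/\ v' q = av %/ bv, v' r = av %% bv &
        forall y, y \notin [:: q; r; 30] -> v' y = v y]).
Proof.
rewrite /= !inE !negb_or => /andP[/andP[qr q30] /andP[r30 _]] xq vx b0 ea aM.
apply: cdivmodP => // v' f; rewrite /= f // !inE !negb_or; exact: xq.
Qed.

Lemma cdivmodC q r a b v av : uniq [:: q; r; 30] ->
  0 < b -> eval v a = av -> av <= M ->
  computes (cdivmod q r a (EC b)) v (fun v' =>
    [/\ v' q = av %/ b, v' r = av %% b &
        forall y, y \notin [:: q; r; 30] -> v' y = v y]).
Proof.
rewrite /= !inE !negb_or => /andP[/andP[qr q30] /andP[r30 _]] b0 ea aM.
exact: cdivmodP.
Qed.

Variables (k m Q : nat).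
Hypothesis k_gt0 : 0 < k.
Hypothesis Q_gt0 : 0 < Q.

Definition ctop (t x : nat) : cmd :=
  CSeq (cdivmod t 13 (EV x) (EV 1))
    (CSeq (cdivmod t 13 (EV t) (EV 1)) (cdivmod t 13 (EV t) (EV 1))).

Lemma ctopP t x v : v 1 = Q -> v x <= M -> t \in [:: 10; 11] ->
  computes (ctop t x) v (fun v' =>
    v' t = top Q (v x) /\ forall y, y \notin [:: t; 13; 30] -> v' y = v y).
Proof.
move=> v1 xM t10.
have tE : uniq [:: t; 13; 30] && (1 \notin [:: t; 13; 30]).
  by move: t10; rewrite !inE => /orP[] /eqP ->.
case/andP: tE => ut nt.
apply: (computes_seq (cdivmodV ut nt v1 Q_gt0 (a := EV x) erefl xM)).
move=> w1 [e1 _ f1].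
have m1 : w1 t <= M by rewrite e1; apply: leq_trans xM; apply: leq_div.
have w11 : w1 1 = Q by rewrite f1.
apply: (computes_seq (cdivmodV ut nt w11 Q_gt0 (a := EV t) erefl m1)).
move=> w2 [e2 _ f2].
have m2 : w2 t <= M by rewrite e2; apply: leq_trans m1; apply: leq_div.
have w21 : w2 1 = Q by rewrite f2.
apply: (computes_weaken (cdivmodV ut nt w21 Q_gt0 (a := EV t) erefl m2)).
move=> w3 [e3 _ f3]; split; first by rewrite e3 /= e2 /= e1.
by move=> y hy; rewrite f3 // f2 // f1.
Qed.

Definition eLitHit : expr :=
  eOr (eAnd (eEq (EV 16) (EC 0))
         (eOr (eEq (EV 28) (EV 24))
              (eAnd (eEq (EV 17) (EV 26)) (eLt (EV 27) (EV 14)))))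
      (eAnd (eEq (EV 16) (EC 1))
         (eAnd (eEq (EV 17) (EV 26)) (eLe (ESub (EV 1) (EV 27)) (EV 14)))).

(** Cells 23 and 24 get the variable and the sign of the literal, 25 and 26 its bit position and
    group. Halving 27 leaves the wanted bit of the guess in 28; then 27 is restored for the
    comparisons. Results accumulate in 22 by disjunction. *)
Definition cliteral (x off : nat) : cmd :=
  CSeq (cdivmod 23 24 (EIn (EAdd (EC off)
                        (EAdd (EV 21) (EAdd (EV 21) (EV 21))))) (EC 2))
  (CSeq (cdivmod 25 26 (EV 23) (EC k))
  (CSeq (CSet 27 (EV x))
  (CSeq (CFor 29 (EV 25) (cdivmod 27 28 (EV 27) (EC 2)))
  (CSeq (cdivmod 27 28 (EV 27) (EC 2))
  (CSeq (CSet 27 (EV x))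
  (CSet 22 (eOr (EV 22) eLitHit))))))).

Lemma cliteralP x off v (p : bool) : x < 22 ->
  v 1 = Q -> v x <= M -> v 22 = p -> inp (off + v 21 * 3) <= M ->
  computes (cliteral x off) v (fun v' =>
    v' 22 = p || literal_hit k Q (v 16) (v 17) (v 14) (v x) (inp (off + v 21 * 3))
    /\ forall y, y < 22 -> v' y = v y).
Proof.
move=> x22 v1 xM vp lM; set l := inp _ in lM *.
have le0 : eval v (EIn (EAdd (EC off) (EAdd (EV 21) (EAdd (EV 21) (EV 21))))) = l.
  by rewrite /l /=; congr inp; lia.
apply: (computes_seq (cdivmodC (q := 23) (r := 24) isT (isT : 0 < 2) le0 lM)).
move=> w1 [e1 e1' f1].
have m1 : w1 23 <= M by rewrite e1; apply: leq_trans lM; apply: leq_div.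
apply: (computes_seq (cdivmodC (q := 25) (r := 26) (a := EV 23) isT k_gt0 erefl m1)).
move=> w2 [e2 e2' f2]; apply: computes_set_seq; set w3 := upd w2 27 _.
have f3 y : y != 27 -> w3 y = w2 y by rewrite /w3 /upd => /negPf ->.
have w3x : w3 27 = v x.
  by rewrite /w3 /upd /= f2 ?f1 // !inE; move: x22; lia.
have w325 : w3 25 = l %/ 2 %/ k by rewrite f3 // e2 /= e1.
have m3 : l %/ 2 %/ k <= M.
  by rewrite -e1; apply: leq_trans m1; apply: leq_div.
pose I i (w : nat -> nat) := w 27 = v x %/ 2 ^ i /\
  forall y, y \notin [:: 27; 28; 29; 30] -> w y = w3 y.
have I0 : I 0 w3 by split; rewrite // expn0 divn1.
apply: (computes_seq (computes_for (e := EV 25) (I := I) w325 m3 I0 _)).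
  move=> i w hi [hw fw]; set w' := upd w 29 i.
  have ew : eval w' (EV 27) = v x %/ 2 ^ i by rewrite /= /w' /upd /= hw.
  have mw : v x %/ 2 ^ i <= M by apply: leq_trans xM; apply: leq_div.
  apply: (computes_weaken (cdivmodC (q := 27) (r := 28) isT (isT : 0 < 2) ew mw)).
  move=> w4 [e4 _ f4]; split; first by rewrite e4 expnSr divnMA.
  move=> y; rewrite !inE !negb_or => /and4P[y27 y28 y29 y30].
  rewrite f4 ?inE ?negb_or ?y27 ?y28 ?y30 // /w' /upd (negPf y29) fw //.
  by rewrite !inE !negb_or y27 y28 y29.
move=> w4 [e4 f4].
have m4 : v x %/ 2 ^ (l %/ 2 %/ k) <= M by apply: leq_trans xM; apply: leq_div.
apply: (computes_seq (cdivmodC (q := 27) (r := 28) (a := EV 27) isT (isT : 0 < 2) e4 m4)).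
move=> w5 [_ e5 f5]; apply: computes_set_seq; set w6 := upd w5 27 _.
have f6 y : y != 27 -> w6 y = w5 y by rewrite /w6 /upd => /negPf ->.
have back y : y < 22 -> w6 y = v y.
  by move=> hy; rewrite f6 ?f5 ?f4 ?f3 ?f2 ?f1 //; rewrite ?inE; lia.
have w6x : w6 27 = v x.
  rewrite /w6 /upd /= f5 ?f4 ?f3 ?f2 ?f1 //; rewrite ?inE; lia.
have w622 : w6 22 = p by rewrite f6 // f5 // f4 // f3 // f2 // f1.
have w624 : w6 24 = l %% 2 by rewrite f6 // f5 // f4 // f3 // f2.
have w626 : w6 26 = l %/ 2 %% k by rewrite f6 // f5 // f4 // f3 // e2' /= e1.
have w628 : w6 28 = v x %/ 2 ^ (l %/ 2 %/ k) %% 2 by rewrite f6.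
apply: computes_set; split; last first.
  by move=> y hy; rewrite -back // /upd; case: eqP => // h; move: hy; rewrite h.
rewrite /upd eqxx; apply: eval_or => //; rewrite /literal_hit.
rewrite -w624 -w626 -w628 -w6x -!back // -v1 -(back 1) //.
apply: eval_or; apply: eval_and; rewrite ?eval_eq //.
  by apply: eval_or; rewrite ?eval_eq //; apply: eval_and; rewrite ?eval_eq ?eval_lt.
by apply: eval_and; rewrite ?eval_eq ?eval_le.
Qed.

Definition eCheckHit : expr :=
  eAnd (eEq (EV 17) (EV 32))
   (eOr (eAnd (eEq (EV 31) (EC 0))
          (eOr (eAnd (eEq (EV 16) (EC 0)) (eLe (EV 18) (EV 14)))
               (eAnd (eEq (EV 16) (EC 1)) (eLe (ESub (EV 1) (EV 18)) (EV 14)))))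
   (eOr (eAnd (eEq (EV 31) (EC 1)) (eEq (EV 16) (EC 1)))
        (eAnd (eEq (EV 31) (EC 2))
          (eOr (eAnd (eEq (EV 16) (EC 0)) (eLt (EV 18) (EV 14)))
          (eOr (eAnd (eEq (EV 16) (EC 1)) (eLe (ESub (EV 1) (EV 18)) (EV 14)))
               (eEq (EV 16) (EC 2))))))).

(** For the column vertex, 14 is the choice, 15 the column, 16 its block and 17 its group. For the
    row, 18 to 20 are the digits and 21 the leading part; 31 and 32 are the type and group of a
    check row. *)
Definition ccross : cmd :=
  CSeq (cdivmod 12 14 (EV 8) (EV 1))
  (CSeq (cdivmod 12 15 (EV 12) (EV 1))
  (CSeq (cdivmod 16 17 (EV 15) (EC k))
  (CSeq (cdivmod 21 18 (EV 9) (EV 1))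
  (CSeq (cdivmod 21 19 (EV 21) (EV 1))
  (CSeq (cdivmod 21 20 (EV 21) (EV 1))
  (CIf (eLt (EV 21) (EIn (EC 1)))
     (CSeq (CSet 22 (EC 0))
     (CSeq (cliteral 18 2) (CSeq (cliteral 19 3) (cliteral 20 4))))
     (CSeq (cdivmod 31 32 (ESub (EV 21) (EIn (EC 1))) (EC k))
           (CSet 22 eCheckHit)))))))).

Hypothesis inp1 : inp 1 = m.

Lemma ccrossP v : v 1 = Q -> v 8 <= M -> v 9 <= M ->
  (top Q (v 9) < m -> forall i, i < 3 -> inp (2 + i + top Q (v 9) * 3) <= M) ->
  computes ccross v (fun v' =>
    v' 22 = cross k m Q inp (v 8) (v 9) /\ forall y, y < 12 -> v' y = v y).
Proof.
move=> v1 xM yM litM; have divM a b : a <= M -> a %/ b <= M.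
  by move=> h; apply: leq_trans h; apply: leq_div.
have modM a b : a <= M -> a %% b <= M.
  by move=> h; apply: leq_trans h; apply: leq_mod.
apply: (computes_seq (cdivmodV (x := 1) (q := 12) (r := 14) (a := EV 8) isT isT v1 Q_gt0 erefl xM)).
move=> w1 [e1 e1' f1].
have q1 : w1 1 = Q by rewrite f1.
have a1 : eval w1 (EV 12) = v 8 %/ Q by [].
apply: (computes_seq (cdivmodV (x := 1) (q := 12) (r := 15) isT isT q1 Q_gt0 a1 _)); first exact: divM.
move=> w2 [e2 e2' f2].
have q2 : w2 1 = Q by rewrite f2.
have a2 : eval w2 (EV 15) = dig2 Q (v 8) by [].
apply: (computes_seq (cdivmodC (q := 16) (r := 17) isT k_gt0 a2 _)).
  exact/modM/divM.
move=> w3 [e3 e3' f3].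
have q3 : w3 1 = Q by rewrite f3.
have a3 : eval w3 (EV 9) = v 9 by rewrite /= f3 // f2 // f1.
apply: (computes_seq (cdivmodV (x := 1) (q := 21) (r := 18) isT isT q3 Q_gt0 a3 yM)).
move=> w4 [e4 e4' f4].
have q4 : w4 1 = Q by rewrite f4.
have a4 : eval w4 (EV 21) = v 9 %/ Q by [].
apply: (computes_seq (cdivmodV (x := 1) (q := 21) (r := 19) isT isT q4 Q_gt0 a4 _)); first exact: divM.
move=> w5 [e5 e5' f5].
have q5 : w5 1 = Q by rewrite f5.
have a5 : eval w5 (EV 21) = v 9 %/ Q %/ Q by [].
apply: (computes_seq (cdivmodV (x := 1) (q := 21) (r := 20) isT isT q5 Q_gt0 a5 _)).
  exact/divM/divM.
move=> w6 [e6 e6' f6].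
have q6 : w6 1 = Q by rewrite f6.
have back y : y < 12 -> w6 y = v y.
  move=> hy; have ny z : 12 <= z -> (y == z) = false by lia.
  by rewrite f6 ?f5 ?f4 ?f3 ?f2 ?f1 // !inE !ny.
have w614 : w6 14 = dig1 Q (v 8) by rewrite f6 // f5 // f4 // f3 // f2 // e1'.
have w616 : w6 16 = dig2 Q (v 8) %/ k by rewrite f6 // f5 // f4 // e3.
have w617 : w6 17 = dig2 Q (v 8) %% k by rewrite f6 // f5 // f4 // e3'.
have w618 : w6 18 = dig1 Q (v 9) by rewrite f6 // f5 // e4'.
have w619 : w6 19 = dig2 Q (v 9) by rewrite f6 // e5'.
have w620 : w6 20 = dig3 Q (v 9) by [].
have w621 : w6 21 = top Q (v 9) by [].
move: {w1 w2 w3 w4 w5 e1 e1' f1 q1 a1 e2 e2' f2 q2 a2 e3 e3' f3 q3 a3 e4 e4' f4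
  q4 a4 e5 e5' f5 q5 a5 e6 e6' f6} w6 q6 back w614 w616 w617 w618 w619 w620 w621.
move=> w q back w14 w16 w17 w18 w19 w20 w21.
have condE : eval w (eLt (EV 21) (EIn (EC 1))) = (top Q (v 9) < m).
  by rewrite eval_lt /= inp1 w21.
apply: computes_if; rewrite condE; case: ltnP => // ht _; rewrite /cross /hit.
  rewrite ht; apply: computes_set_seq; set u0 := upd w 22 0.
  have g0 y : y < 22 -> u0 y = w y.
    by move=> hy; rewrite /u0 /upd; case: eqP => // h; move: hy; rewrite h.
  have l1 : inp (2 + u0 21 * 3) <= M by rewrite g0 // w21 (litM ht 0).
  apply: (computes_seq (cliteralP (x := 18) (p := false) _ _ _ _ l1)) => //.
    by rewrite g0 // w18 modM.
  move=> u1 [r1 g1].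
  have l2 : inp (3 + u1 21 * 3) <= M by rewrite g1 // g0 // w21 (litM ht 1).
  apply: (computes_seq (cliteralP (x := 19) _ _ _ r1 l2)) => //.
  - by rewrite g1 // g0.
  - by rewrite g1 // g0 // w19; apply/modM/divM.
  move=> u2 [r2 g2].
  have l3 : inp (4 + u2 21 * 3) <= M by rewrite g2 // g1 // g0 // w21 (litM ht 2).
  apply: (computes_weaken (cliteralP (x := 20) _ _ _ r2 l3)) => //.
  - by rewrite g2 // g1 // g0.
  - by rewrite g2 // g1 // g0 // w20; apply/modM/divM/divM.
  move=> u3 [r3 g3]; split; last first.
    move=> y hy; have hy' : y < 22 by lia.
    by rewrite g3 // g2 // g1 // g0 // back.
  rewrite r3 /clause_hit !g2 // !g1 // !g0 // w14 w16 w17 w18 w19 w20 w21.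
  by rewrite /= orbA.
have a7 : eval w (ESub (EV 21) (EIn (EC 1))) = top Q (v 9) - m.
  by rewrite /= w21 inp1.
have m7 : top Q (v 9) - m <= M.
  by apply: leq_trans (leq_subr _ _) _; do 3! apply: (divM).
apply: (computes_seq (cdivmodC (q := 31) (r := 32) isT k_gt0 a7 m7)).
move=> u [e7 e7' f7]; apply: computes_set; split; last first.
  move=> y hy; rewrite -back // -f7 ?inE; last by lia.
  by rewrite /upd; case: eqP => // h; move: hy; rewrite h.
have -> : (top Q (v 9) < m) = false by rewrite ltnNge ht.
rewrite /upd eqxx.
rewrite /check_hit -e7 -e7' -w14 -w16 -w17 -w18 -q -!f7 //.
rewrite /eCheckHit; do ? [apply: eval_or | apply: eval_and];
  by rewrite ?eval_eq ?eval_le ?eval_lt.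
Qed.

(** The outer [eEq] compares two truth values, that is, tests whether both vertices lie in the same
    clique. *)
Definition cadj : cmd :=
  CSeq (ctop 10 6) (CSeq (ctop 11 7)
  (CIf (eEq (EV 6) (EV 7)) (CSet 22 (EC 0))
  (CIf (eEq (eEq (EV 10) (EAdd (EIn (EC 1)) (EC (3 * k))))
            (eEq (EV 11) (EAdd (EIn (EC 1)) (EC (3 * k)))))
     (CSet 22 (EC 1))
  (CIf (eEq (EV 10) (EAdd (EIn (EC 1)) (EC (3 * k))))
     (CSeq (CSet 8 (EV 6)) (CSeq (CSet 9 (EV 7)) ccross))
     (CSeq (CSet 8 (EV 7)) (CSeq (CSet 9 (EV 6)) ccross)))))).

Hypothesis litM : forall c i, c < m -> i < 3 -> inp (2 + i + c * 3) <= M.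

Lemma cadjP N v (i j : 'I_N) : N <= M -> v 1 = Q -> v 6 = i -> v 7 = j ->
  computes cadj v (fun v' =>
    v' 22 = sat_graph k m Q inp i j /\ forall y, y < 8 -> v' y = v y).
Proof.
move=> NM v1 vi vj.
have iM : v 6 <= M by rewrite vi (leq_trans _ NM) // ltnW.
have jM : v 7 <= M by rewrite vj (leq_trans _ NM) // ltnW.
apply: (computes_seq (ctopP v1 iM _)) => // w1 [e1 f1].
have w11 : w1 1 = Q by rewrite f1.
have w17 : w1 7 <= M by rewrite f1.
apply: (computes_seq (ctopP (t := 11) w11 w17 _)) => // w2 [e2 f2].
have back y : y < 8 -> w2 y = v y.
  by move=> hy; rewrite f2 ?f1 //; rewrite ?inE; lia.
have w210 : w2 10 = top Q i by rewrite f2 // e1 vi.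
have w211 : w2 11 = top Q j by rewrite e2 f1 // vj.
have w21 : w2 1 = Q by rewrite back.
have w26 : w2 6 = i by rewrite back.
have w27 : w2 7 = j by rewrite back.
have inE10 : eval w2 (eEq (EV 10) (EAdd (EIn (EC 1)) (EC (3 * k)))) = in_col k m Q i.
  by rewrite eval_eq /= inp1 w210.
have inE11 : eval w2 (eEq (EV 11) (EAdd (EIn (EC 1)) (EC (3 * k)))) = in_col k m Q j.
  by rewrite eval_eq /= inp1 w211.
have setP c (r : nat) : eval w2 (EC c) = r -> computes (CSet 22 (EC c)) w2 (fun v' =>
    v' 22 = r /\ forall y, y < 8 -> v' y = v y).
  move=> er; apply: computes_set; split; first by rewrite /upd eqxx er.
  by move=> y hy; rewrite -back // /upd; case: eqP => // h; move: hy; rewrite h.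
have crossP x y (a b : nat) : w2 x = a -> w2 y = b -> a <= M -> b <= M ->
    x != 8 -> y != 8 ->
    computes (CSeq (CSet 8 (EV x)) (CSeq (CSet 9 (EV y)) ccross)) w2 (fun v' =>
      v' 22 = cross k m Q inp a b /\ forall y, y < 8 -> v' y = v y).
  move=> ex ey aM bM x8 y8; do 2! apply: computes_set_seq; set u := upd _ 9 _.
  have u8 : u 8 = a by rewrite /u /upd /= ex.
  have u9 : u 9 = b by rewrite /u /upd /= (negPf y8) ey.
  apply: (computes_weaken (@ccrossP u _ _ _ _)); rewrite ?u8 ?u9 //.
    by move=> ht i' hi'; apply: litM.
  move=> v' [r f]; split=> // z hz; rewrite f; last by lia.
  by rewrite -back // /u /upd; do 2! (case: eqP => [h|_]; first by move: hz; rewrite h).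
have ijE : eval w2 (eEq (EV 6) (EV 7)) = (i == j).
  by rewrite eval_eq /= w26 w27.
rewrite /sat_graph /two_cliques /clique_rel.
apply: computes_if; rewrite ijE; case: (i == j) => //= _.
  exact: setP.
apply: computes_if; rewrite eval_eq inE10 inE11.
  move=> h; have -> : in_col k m Q i == in_col k m Q j.
    by move: h; case: (in_col k m Q i); case: (in_col k m Q j).
  exact: setP.
move=> h; have -> : (in_col k m Q i == in_col k m Q j) = false.
  by move: h; case: (in_col k m Q i); case: (in_col k m Q j).
by apply: computes_if; rewrite inE10; case: (in_col k m Q i) => // _;
  apply: crossP => //; rewrite -?vi -?vj.
Qed.
End Programs.

Definition cprint (k : nat) : cmd :=
  CSeq (COut (EV 0)) (CSeq (COut (EC (3 * k)))
  (CFor 6 (EV 0) (CFor 7 (EV 0) (CSeq (cadj k) (COut (EV 22)))))).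

Lemma den_for inp M x e c st n (I : nat -> vstate -> Prop) :
  eval inp st.1 e = n -> n <= M -> I 0 st ->
  (forall i st', i < n -> I i st' -> I i.+1 (den inp M c (upd st'.1 x i, st'.2))) ->
  I n (den inp M (CFor x e c) st).
Proof.
move=> en hM h0 hS /=; rewrite en (minn_idPl hM).
suff : forall i, i <= n ->
    I i (iteri i (fun j st => den inp M c (upd st.1 x j, st.2)) st) by apply.
elim=> [|i IH] hi //=; exact: hS (IH (ltnW hi)).
Qed.

Lemma den_seq inp M c1 c2 st :
  den inp M (CSeq c1 c2) st = den inp M c2 (den inp M c1 st).
Proof. by []. Qed.

Lemma den_out inp M e st :
  den inp M (COut e) st = (st.1, rcons st.2 (eval inp st.1 e)).
Proof. by []. Qed.

#[local] Arguments den : simpl never.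

Lemma cprintP inp M k m Q N v : 0 < k -> 0 < Q -> inp 1 = m ->
  (forall c i, c < m -> i < 3 -> inp (2 + i + c * 3) <= M) ->
  N <= M -> v 0 = N -> v 1 = Q ->
  (den inp M (cprint k) (v, [::])).2 =
  graph_input (sat_graph k m Q inp (N := N)) (3 * k).
Proof.
move=> k0 Q0 inp1 litM NM v0 v1.
(* Extends the adjacency matrix by 0 to all numbers, so that enumerations of ordinals become ranges
   of [iota]. *)
pose f i j : nat := if insub i is Some i' then
  if insub j is Some j' then sat_graph k m Q inp (N := N) i' j' : nat else 0 else 0.
have fE (i j : 'I_N) : f i j = sat_graph k m Q inp i j by rewrite /f !valK.
have -> : graph_input (sat_graph k m Q inp (N := N)) (3 * k) =
    [:: N, 3 * k & [seq f i j | i <- iota 0 N, j <- iota 0 N]].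
  rewrite /graph_input; congr [:: _, _ & _].
  rewrite -val_enum_ord allpairs_mapl allpairs_mapr.
  by apply: eq_allpairs => i j; rewrite fE.
rewrite /cprint !den_seq !den_out /=; set st0 := (v, _).
pose good (w : nat -> nat) := w 0 = N /\ w 1 = Q.
pose I i (st : vstate) := good st.1 /\
  st.2 = [:: N, 3 * k & [seq f i j | i <- iota 0 i, j <- iota 0 N]].
suff [_ -> //] : I N (den inp M (CFor 6 (EV 0) (CFor 7 (EV 0)
    (CSeq (cadj k) (COut (EV 22))))) st0).
apply: den_for => //; first by rewrite /st0 v0.
move=> i [w o] iN [[]] /= w0 w1 -> {o}; set o := _ :: _; set w' := upd w 6 i.
pose J j (st : vstate) := [/\ good st.1, st.1 6 = i &
  st.2 = o ++ [seq f i j | j <- iota 0 j]].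
suff [gs _ h] : J N (den inp M (CFor 7 (EV 0) (CSeq (cadj k) (COut (EV 22)))) (w', o)).
  split=> //; rewrite h /o -[i.+1]addn1 iotaD allpairs_cat add0n.
  by rewrite /= cats0.
apply: den_for => //; first by rewrite /J /= cats0.
move=> j [u o'] jN [[u0 u1] u6 eo'].
have [|||u' e [r fr]] := @cadjP inp M k m Q k0 Q0 inp1 litM N (upd u 7 j)
  (Ordinal iN) (Ordinal jN) NM _ _ _ o' => //.
have e' : den inp M (cadj k) (upd u 7 j, o') = (u', o') by [].
rewrite den_seq e' den_out; split.
- by split; rewrite /= fr.
- by rewrite /= fr.
- rewrite -[j.+1]addn1 iotaD map_cat add0n catA -eo' /= -cats1 r.
  by rewrite -(fE (Ordinal iN) (Ordinal jN)).
Qed.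

(** Without multiplication, [Q] in variable 1 and its cube in variable 2 are kept up by doublings,
    one and three of them per [k] rounds counted by variable 3; the order of the graph is a repeated
    sum of the cube. Variable 4 is the loop bound for printing: it covers all vertices and all
    literal codes, which are below [2 n]. *)
Definition cinit (k q0 : nat) : cmd :=
  CSeq (CSet 1 (EC q0)) (CSeq (CSet 2 (EC (q0 ^ 3))) (CSeq (CSet 3 (EC 0))
  (CSeq (CFor 5 (EIn (EC 0))
    (CSeq (CSet 3 (EAdd (EV 3) (EC 1)))
    (CIf (eEq (EV 3) (EC k))
      (CSeq (CSet 3 (EC 0)) (CSeq (CSet 1 (EAdd (EV 1) (EV 1)))
      (CSeq (CSet 2 (EAdd (EV 2) (EV 2))) (CSeq (CSet 2 (EAdd (EV 2) (EV 2)))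
            (CSet 2 (EAdd (EV 2) (EV 2)))))))
      (CSet 3 (EV 3)))))
  (CSeq (CSet 0 (EC 0))
  (CSeq (CFor 5 (EAdd (EIn (EC 1)) (EC (3 * k + 1)))
    (CSet 0 (EAdd (EV 0) (EV 2))))
  (CSet 4 (EAdd (EV 0) (EAdd (EIn (EC 0)) (EIn (EC 0)))))))))).

Lemma divn_modn_succ k i : 0 < k ->
  if (i %% k).+1 == k then (i.+1 %/ k = (i %/ k).+1) /\ (i.+1 %% k = 0)
  else (i.+1 %/ k = i %/ k) /\ (i.+1 %% k = (i %% k).+1).
Proof.
move=> k0; have iE := divn_eq i k; have := ltn_mod i k; rewrite k0 => lt.
case: eqP => h.
  have -> : i.+1 = (i %/ k).+1 * k by rewrite {1}iE mulSn; lia.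
  by rewrite mulnK // modnMl.
have -> : i.+1 = i %/ k * k + (i %% k).+1 by rewrite {1}iE; lia.
have lt' : (i %% k).+1 < k by move: lt h; move: (i %% k) => r; lia.
by split; [rewrite divnMDl // (divn_small lt') addn0|rewrite modnMDl modn_small].
Qed.

Lemma cinitP inp M k q0 v n m : 0 < k -> inp 0 = n -> inp 1 = m ->
  n <= M -> m + (3 * k + 1) <= M ->
  computes inp M (cinit k q0) v (fun v' =>
    let Q := q0 * 2 ^ (n %/ k) in let N := (m + 3 * k + 1) * Q ^ 3 in
    [/\ v' 0 = N, v' 1 = Q & v' 4 = N + (n + n)]).
Proof.
move=> k0 i0 i1 nM mM; do 3! apply: computes_set_seq; set v0 := upd _ 3 _.
pose I i (w : nat -> nat) := [/\ w 1 = q0 * 2 ^ (i %/ k),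
  w 2 = (q0 * 2 ^ (i %/ k)) ^ 3 & w 3 = i %% k].
have I0 : I 0 v0 by rewrite /I div0n mod0n expn0 muln1 /v0 /upd.
have en : eval inp v0 (EIn (EC 0)) = n by [].
apply: (computes_seq (computes_for (I := I) en nM I0 _)).
  move=> i w _ [w1 w2 w3]; apply: computes_set_seq.
  have dm := divn_modn_succ i k0; set w' := upd _ 3 _.
  have cE : eval inp w' (eEq (EV 3) (EC k)) = ((i %% k).+1 == k).
    by rewrite eval_eq /= /w' /upd /= w3 addn1.
  apply: computes_if; rewrite cE; move: dm.
    case: eqP => // h [d1 d2] _; do 4! apply: computes_set_seq.
    apply: computes_set; rewrite /I d1 d2 /w' /upd /= w1 w2 expnS.
    by split=> //; [|rewrite !expnMn -!expnM]; lia.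
  case: eqP => // h [d1 d2] _; apply: computes_set.
  by rewrite /I d1 d2 /w' /upd /= w1 w2 w3 addn1.
move=> w [w1 w2 _]; apply: computes_set_seq; set u0 := upd w 0 _.
pose J i (u : nat -> nat) := [/\ u 1 = w 1, u 2 = w 2 & u 0 = i * w 2].
have J0 : J 0 u0 by [].
have em : eval inp u0 (EAdd (EIn (EC 1)) (EC (3 * k + 1))) = m + (3 * k + 1).
  by rewrite /= i1.
apply: (computes_seq (computes_for (I := J) em mM J0 _)).
  move=> i u _ [u1 u2 u3]; apply: computes_set; split=> //.
  by rewrite /upd /= u2 u3 mulSn addnC.
move=> u [u1 u2 u3]; apply: computes_set; rewrite /upd /=.
by rewrite u1 u3 w1 w2 i0 addnA.
Qed.

(** * The 3-SAT solver *)

(* Variables take 33 cells, temporaries the cells from 37 on. *)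
Definition sat_solver (k q0 : nat) (P : program) : program :=
  If 1 (relocate_input 80 (3 * k + 1) ;; ccode 37 (cinit k q0) ;; Copy 0 8 ;;
        ccode 37 (cprint k) ;; reloc P ;; load 0 4 ;; Copy 0 4)
       (Const 0 1).

Lemma size_sat_input n (phi : cnf3 n) : size (sat_input phi) = 3 * size phi + 2.
Proof.
rewrite /sat_input /= -addn2; congr (_ + _).
elim: phi => [|cl phi IH] //=; rewrite size_cat size_map size_tuple IH; lia.
Qed.

Lemma sat_input_literal_lt n (phi : cnf3 n) c i : c < size phi -> i < 3 ->
  nth 0 (sat_input phi) (2 + i + c * 3) < n + n.
Proof.
move=> hc hi; case: phi hc => [//|cl phi] hc.
have l0 : literal n by case: cl hc => -[|l ? _] // _; exact: l.
rewrite (sat_input_clause cl l0) // /literal_code -addnn.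
by move: (nth _ _ _) => -[[x hx] y] /=; case: y; lia.
Qed.

(** The assumed time bound only concerns large graphs; a large [q0] makes every graph produced large
    enough. *)
Lemma graph_order_ge k q0 n m : 0 < q0 ->
  q0 <= (m + 3 * k + 1) * (q0 * 2 ^ (n %/ k)) ^ 3.
Proof.
move=> q00; have p : 0 < 2 ^ (n %/ k) by rewrite expn_gt0.
set Q := q0 * _; have q0Q : q0 <= Q by rewrite leq_pmulr.
have -> : Q ^ 3 = Q * (Q * Q) by rewrite !expnS expn0 muln1.
by have : 0 < Q * Q; nia.
Qed.

Lemma sat_solver_answers (P : program) (k q0 n : nat) (phi : cnf3 n) tP
    (Q := q0 * 2 ^ (n %/ k)) (N := (size phi + 3 * k + 1) * Q ^ 3)
    (e := sat_graph k (size phi) Q (nth 0 (sat_input phi)) (N := N)) :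
  0 < k -> 3 * k < q0 ->
  answers P (graph_input e (3 * k)) (has_upper_dominating e (3 * k)) tP ->
  exists2 t, answers (sat_solver k q0 P) (sat_input phi) (satisfiable phi) t &
    t <= 200 + 27 * size phi + ccost (n + size phi + (3 * k + 1)) (cinit k q0)
         + ccost (N + (n + n)) (cprint k) + 12 * tP.
Proof.
move=> k0 kq [sP eP yesP]; set m := size phi; set inp := nth 0 (sat_input phi).
(* Moving the input needs positive [n] and [m]. Without clauses the answer is yes at once; with a
   clause, some literal witnesses [n > 0]. *)
have [m0|m0] := posnP m.
  exists 2; last by lia.
  exists (upd inp 0 1); first by apply: exec_if_false => //; apply: exec_const.
  split=> // _; rewrite /satisfiable; move: m0; rewrite /m.
  by case: (phi) => // _; exists (fun _ => true).
have n0 : 0 < n.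
  move: m0; rewrite /m; case: (phi) => // cl _ _; case: cl => -[|[v _] ? _] //.
  by apply: leq_ltn_trans (ltn_ord v).
have q00 : 0 < q0 by lia.
have Q0 : 0 < Q by rewrite muln_gt0 q00 expn_gt0.
have iL i : 3 * m + 2 <= i -> inp i = 0.
  by move=> hi; rewrite /inp nth_default // size_sat_input.
have i0 : inp 0 = n by [].
have i1 : inp 1 = m by [].
set M1 := n + m + (3 * k + 1); set M2 := N + (n + n).
have [t [s [ex le yes]]] : runs (sat_solver k q0 P) inp
    ((100 + 27 * m) + (ccost M1 (cinit k q0) + (1 + (ccost M2 (cprint k) +
      (12 * tP + (3 + 1)))))).+1 (fun s => s 0 != 0 <-> satisfiable phi).
  apply: runs_if => [_|]; last by rewrite /inp /=; move: m0; rewrite /m; lia.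
  apply: (runs_seq (relocate_input_runs 80 (3 * k + 1) 33 i0 i1 n0 m0 iL)).
  rewrite -/M1 => s [B [v [KB rs]]].
  have [||v1 d1 [v10 v11 v14]] := @cinitP inp M1 k q0 v n m k0 i0 i1 _ _ [::].
  - by rewrite /M1; lia.
  - by rewrite /M1; lia.
  have wf1 : cwf 33 80 37 (cinit k q0) by [].
  have run1 := ccode_runs (V := 33) KB isT (leqnn (4 + 33)) wf1 rs.
  apply: (runs_seq run1).
  rewrite d1 => {run1 rs}s1 [rs _].
  (* Cell 8 is variable 4, whose value now replaces the loop bound in cell 0. *)
  apply: (runs_step (exec_copy _ _ _)).
  have {rs} rs2 : represents inp 33 B M2 (v1, [::]) (upd s1 0 (s1 8)).
    case: rs => r0 r1 r2 r3 rv ri ro; split=> //=.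
    + by rewrite (rv 4).
    + by move=> i; rewrite -ri; updsimp.
  have wf2 : cwf 33 80 37 (cprint k) by [].
  have run2 := ccode_runs (V := 33) KB isT (leqnn (4 + 33)) wf2 rs2.
  apply: (runs_seq run2).
  move=> {run2 rs2}s2 [rs _].
  have gE : (den inp M2 (cprint k) (v1, [::])).2 = graph_input e (3 * k).
    apply: cprintP => //; rewrite ?v10 ?v11 //; last by rewrite /M2; lia.
    by move=> c i hc hi; have := sat_input_literal_lt hc hi; rewrite /M2 -/inp; lia.
  have Qk : 3 * k < Q by apply: leq_trans kq _; rewrite leq_pmulr // expn_gt0.
  (* As [q0 >= 2], it pays for the extra bit. *)
  have Qn : 2 ^ (n %/ k).+1 <= Q by rewrite expnS leq_mul //; lia.
  have B5 : 5 < B.+1 by lia.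
  have rel : relocated B.+1 (nth 0 (graph_input e (3 * k))) s2.
    by case: rs => _ _ _ r3 _ _ ro; split=> // i; rewrite ro gE.
  have [t' [s' [e' le' rel']]] := reloc_exec B5 eP rel.
  have [s3 [e2 v2 _ _]] := load_exec (d := 4) 0 B5 isT rel'.
  exists (t' + (3 + 1)), (upd s3 0 (s3 4)); split.
  - apply: exec_seq e' _; apply: exec_seq e2 _; exact: exec_copy.
  - by lia.
  - rewrite /upd eqxx v2 yesP; split.
      exact: sat_graph_sound.
    exact: sat_graph_complete.
exists t; first by exists s.
by apply: leq_trans le _; lia.
Qed.

(** * Running time *)

Lemma depth_cprint k : depth (cprint k) = 4.
Proof. by []. Qed.

(** Printing nests four loops of at most about [N] rounds, and [N] is of order [A ^ 3] up to a
    factor polynomial in the formula size, whence the exponent 12. *)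
Lemma sat_solver_overhead k q0 : exists c d, forall n m,
  let A := 2 ^ (n %/ k) in let N := (m + 3 * k + 1) * (q0 * A) ^ 3 in
  200 + 27 * m + ccost (n + m + (3 * k + 1)) (cinit k q0) +
    ccost (N + (n + n)) (cprint k) <= c * (n + m).+1 ^ d * A ^ 12
  /\ N <= (3 * k + 1) * q0 ^ 3 * (n + m).+1 * A ^ 3.
Proof.
have [c1 h1] := ccost_poly (cinit k q0); have [c2 h2] := ccost_poly (cprint k).
move: h2; rewrite depth_cprint => h2.
move: h1; move: (depth _) => d1 h1; set c3 := (3 * k + 1) * q0 ^ 3.
exists (227 + c1 * (3 * k + 2) ^ d1 + c2 * (c3 + 2) ^ 4), (d1 + 4) => n m A N.
set S := (n + m).+1.
have A0 : 0 < A by rewrite expn_gt0.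
have NE : N <= c3 * S * A ^ 3.
  rewrite /N expnMn mulnA leq_mul // /c3 mulnAC leq_mul //.
  by rewrite /S; nia.
split; first clearbody N A; last exact: NE.
have SA : S <= S ^ (d1 + 4) * A ^ 12.
  apply: (@leq_trans (S ^ (d1 + 4))); last by rewrite leq_pmulr // expn_gt0 A0.
  by rewrite -{1}[S]expn1 leq_pexp2l // addn_gt0 orbT.
set X := S ^ (d1 + 4) * A ^ 12 in SA; rewrite -mulnA -/X.
suff [b1 b2 b3] : [/\ 200 + 27 * m <= 227 * X,
    ccost (n + m + (3 * k + 1)) (cinit k q0) <= c1 * (3 * k + 2) ^ d1 * X &
    ccost (N + (n + n)) (cprint k) <= c2 * (c3 + 2) ^ 4 * X].
  by rewrite 2!(mulnDl _ _ X); apply: leq_add (leq_add b1 b2) b3.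
split.
- by have : S <= X := SA; rewrite /S; clear; lia.
- apply: leq_trans (h1 _) _; rewrite -mulnA leq_mul //.
  apply: (@leq_trans (((3 * k + 2) * S) ^ d1)).
    have [->//|d10] := posnP d1.
    rewrite leq_exp2r // /S mulnS.
    have : n + m <= (3 * k + 2) * (n + m) by rewrite leq_pmull // addn2.
    by move: (_ * (n + m)) => y; clear; lia.
  rewrite expnMn leq_mul // /X -[S ^ d1]muln1 leq_mul ?expn_gt0 ?A0 //.
  by rewrite leq_pexp2l // leq_addr.
- apply: leq_trans (h2 _) _; rewrite -mulnA leq_mul //.
  apply: (@leq_trans (((c3 + 2) * (S * A ^ 3)) ^ 4)).
    rewrite leq_exp2r //.
    have A3 : 0 < A ^ 3 by rewrite expn_gt0 A0.
    have SA3 : S <= S * A ^ 3 by rewrite leq_pmulr.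
    have : (N + (n + n)).+1 <= c3 * (S * A ^ 3) + 2 * S.
      by move: NE; rewrite mulnA; move: (c3 * S * A ^ 3) => y; rewrite /S; clear; lia.
    by move/leq_trans; apply; rewrite mulnDl leq_add2l leq_mul2l SA3 orbT.
  have -> : ((c3 + 2) * (S * A ^ 3)) ^ 4 = (c3 + 2) ^ 4 * (S ^ 4 * A ^ 12).
    by rewrite (expnMn (c3 + 2)) (expnMn S) -(expnM A 3 4).
  rewrite leq_mul2l /X leq_mul2r; apply/orP; right; apply/orP; right.
  by rewrite leq_pexp2l // leq_addl.
Qed.

Local Open Scope classical_set_scope.
Local Open Scope ring_scope.

Section RealBounds.
Variable R : realType.

Lemma natr_pow2_le (delta : R) (n k c : nat) : (0 < k)%N ->
  c%:R <= delta * k%:R ->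
  ((2 ^ (n %/ k)) ^ c)%:R <= 2 `^ (delta * n%:R) :> R.
Proof.
move=> k0 ck; have kR : 0 < k%:R :> R by rewrite ltr0n.
have d0 : 0 <= delta.
  by rewrite -(pmulr_lge0 _ kR) (le_trans _ ck).
rewrite -expnM natrX -powR_mulrn // ler_powR ?ler1n //.
rewrite mulnC natrM (le_trans (ler_wpM2r _ ck)) //.
rewrite -mulrA ler_wpM2l // -natrM ler_nat mulnC; exact: leq_trunc_div.
Qed.

(** The exponent is at most [e = delta k / 3], a constant once [k] is fixed. So the factor [S] stays
    polynomial, while the cube of [2 ^ (n / k)] raised to [e] is at most [2 ^ (delta n)]. *)
Lemma powR_graph_order (delta g : R) (N S c n k : nat) : (0 < k)%N -> 0 <= delta ->
  (0 < N)%N -> (N <= c * S * (2 ^ (n %/ k)) ^ 3)%N -> (0 < S)%N ->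
  g <= delta / 9 * (3 * k)%:R ->
  N%:R `^ g <= c%:R `^ (delta * k%:R / 3) *
     S%:R ^+ (Num.trunc (delta * k%:R / 3)).+1 * 2 `^ (delta * n%:R).
Proof.
move=> k0 d0 N0 Nle S0 gle; set e := delta * k%:R / 3.
have e0 : 0 <= e by rewrite !mulr_ge0.
have ge : g <= e.
  by apply: le_trans gle _; rewrite /e natrM; lra.
apply: (le_trans (ler_powR _ ge)); first by rewrite ler1n.
apply: (@le_trans _ _ ((c * S * (2 ^ (n %/ k)) ^ 3)%:R `^ e)).
  by rewrite ge0_ler_powR // ?nnegrE ?ler_nat.
rewrite (natrM R (c * S)) (natrM R c) !powRM ?mulr_ge0 //.
rewrite ler_pM ?mulr_ge0 ?powR_ge0 //.
  rewrite ler_wpM2l ?powR_ge0 // -powR_mulrn // ler_powR ?ler1n //.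
  by rewrite ltW // truncnS_gt.
rewrite -expnM natrX -powR_mulrn // -powRrM ler_powR ?ler1n //.
have -> : (n %/ k * 3)%:R * e = delta * (n %/ k * k)%:R.
  by rewrite /e !natrM; field.
by rewrite ler_wpM2l // ler_nat leq_trunc_div.
Qed.
End RealBounds.

Theorem theorem1 (R : realType) :
  ETH R ->
  ~ exists (P : program) (g : nat -> R),
      g =o_\oo (fun k : nat => k%:R : R) /\
      solves_UDS_in_time_O P (fun n k : nat => n%:R `^ g k).
Proof.
move=> [delta d0 noP] [P [g [/eqoP go [C [n0 hP]]]]]; apply: noP.
(* The parameter [3 k] and the cube in the order of the graph each cost a factor 3. *)
have e0 : 0 < delta / 9 by rewrite divr_gt0.
have [K1 _ hK] := go _ e0.
(* Past [K1] the bound on [g] holds, and [k >= 12 / delta] brings the printing time, of order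
   [(2 ^ (n / k)) ^ 12], within [2 ^ (delta n)]. *)
pose k := (K1 + (Num.trunc (12 / delta)).+1)%N.
have k0 : (0 < k)%N by rewrite addn_gt0 orbT.
have dk : 12 <= delta * k%:R.
  rewrite mulrC -ler_pdivrMr // /k natrD.
  have := truncnS_gt (12 / delta); have : 0 <= K1%:R :> R by [].
  by lra.
have gk : g (3 * k)%N <= delta / 9 * (3 * k)%:R.
  have K1k : (K1 <= 3 * k)%N by rewrite /k; lia.
  have := hK _ K1k; rewrite /= (ger0_norm (ler0n R (3 * k))) => h.
  exact: le_trans (ler_norm _) h.
(* The summand [3 k + 1] makes room for the columns, and [n0] makes the graph large enough for the
   time bound. *)
pose q0 := (3 * k + n0 + 1)%N.
have [kq q00 n0q] : [/\ (3 * k < q0)%N, (0 < q0)%N & (n0 <= q0)%N].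
  by rewrite /q0; split; clear; lia.
have [c [d hc]] := sat_solver_overhead k q0.
pose e := delta * k%:R / 3.
pose c3 := ((3 * k + 1) * q0 ^ 3)%N; pose d' := (Num.trunc e).+1.
exists (sat_solver k q0 P), (c%:R + 12 * (`|C| * c3%:R `^ e)), (d + d')%N => n phi.
set Q := (q0 * 2 ^ (n %/ k))%N; set N := ((size phi + 3 * k + 1) * Q ^ 3)%N.
set G := sat_graph k (size phi) Q (nth 0 (sat_input phi)) (N := N).
have [tP aP tle] := hP N G (3 * k)%N (two_cliques_sym _ _) (two_cliques_irr _ _).
have [t at_ tt] := sat_solver_answers k0 kq aP.
exists t => //.
have [h1 h2] := hc n (size phi).
have N0 : (q0 <= N)%N by apply: graph_order_ge.
(* The constant [C] is not known to be nonnegative. *)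
have {}tle : tP%:R <= `|C| * N%:R `^ g (3 * k)%N.
  apply: le_trans (tle _) _; first exact: leq_trans n0q N0.
  by rewrite ler_wpM2r ?powR_ge0 // ler_norm.
set S := (n + size phi).+1 in h1 h2 *.
have S1 : 1 <= S%:R :> R by rewrite ler1n.
set D := 2 `^ (delta * n%:R).
have D0 : 0 <= D by apply: powR_ge0.
have main : ((2 ^ (n %/ k)) ^ 12)%:R <= D by apply: natr_pow2_le.
have graph : N%:R `^ g (3 * k)%N <= c3%:R `^ e * S%:R ^+ d' * D.
  by apply: powR_graph_order => //; [exact: ltW|exact: leq_trans q00 N0].
apply: (@le_trans _ _ (c%:R * S%:R ^+ (d + d') * D +
    12 * (`|C| * (c3%:R `^ e * S%:R ^+ (d + d') * D)))); last first.
  by rewrite le_eqVlt; apply/orP; left; apply/eqP; ring.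
have tb : t%:R <= c%:R * S%:R ^+ d * ((2 ^ (n %/ k)) ^ 12)%:R + 12 * tP%:R :> R.
  rewrite -natrX -!natrM -natrD ler_nat; apply: leq_trans tt _.
  by rewrite leq_add2r.
apply: le_trans tb _; apply: lerD.
  rewrite ler_pM ?mulr_ge0 ?exprn_ge0 // ler_wpM2l //.
  by rewrite ler_weXn2l // leq_addr.
rewrite ler_wpM2l // (le_trans tle) // ler_wpM2l // (le_trans graph) //.
rewrite ler_wpM2r // ler_wpM2l ?powR_ge0 //.
by rewrite ler_weXn2l // leq_addl.
Qed.
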